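(* Let $\mathcal{T}(\mathbb{R})$ denote the family of all topologically transitive continuous maps $f\colon\mathbb{R}\to\mathbb{R}$. Then $$\inf\{\operatorname{ent}(f) : f\in\mathcal{T}(\mathbb{R})\}=\log\sqrt{3},$$ and no map in $\mathcal{T}(\mathbb{R})$ attains this bound, i.e. there is no $f\in\mathcal{T}(\mathbb{R})$ with $\operatorname{ent}(f)=\log\sqrt{3}$.
   Context: A continuous map $f\colon X\to X$ of a metric space is (topologically) transitive if for all nonempty open $U,V\subset X$ there is a positive integer $n$ with $f^n(U)\cap V\neq\emptyset$. For a compact set $K\subset X$ with $f(K)\subset K$, $h(f|_K)\in[0,+\infty]$ denotes the usual topological entropy of $f|_K\colon K\to K$ (natural logarithm). The Cánovas–Rodríguez entropy is $\operatorname{ent}(f)=\sup\{h(f|_K) : K\subset X \text{ nonempty, compact, } f(K)\subset K\}$, with the convention $\operatorname{ent}(f)=\infty$ if there is no such $K$. *)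

(* Defs.v *)
From HB Require Import structures.
From mathcomp Require Import all_boot all_order all_algebra.
From mathcomp Require Import finmap.
From mathcomp Require Import all_classical all_reals all_analysis.

Set Implicit Arguments.
Unset Strict Implicit.
Unset Printing Implicit Defensive.

Import Order.TTheory GRing.Theory Num.Theory.
Import numFieldNormedType.Exports.

Local Open Scope classical_set_scope.
Local Open Scope ring_scope.

Definition topologically_transitive (X : topologicalType) (f : X -> X) : Prop :=
  forall U V : set X, open U -> open V -> U !=set0 -> V !=set0 ->
    exists n : nat, (0 < n)%N /\ (iter n f @` U) `&` V !=set0.

Definition bowen_dist (R : realType) (f : R -> R) (n : nat) (x y : R) : R :=
  \big[Num.max/0]_(i < n) `|iter i f x - iter i f y|.

Definition dyn_separated (R : realType) (f : R -> R) (n : nat) (e : R)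
    (E : {fset R}) : Prop :=
  forall x y : R, x \in E -> y \in E -> x != y -> e < bowen_dist f n x y.

Definition sep_number (R : realType) (f : R -> R) (K : set R) (n : nat)
    (e : R) : \bar R :=
  ereal_sup [set (#|` E|%:R)%:E | E in
    [set E : {fset R} | [set` E] `<=` K /\ dyn_separated f n e E]].

Definition sep_growth (R : realType) (f : R -> R) (K : set R) (e : R) : \bar R :=
  limn_esup (fun n : nat => (n%:R^-1)%:E * lne (sep_number f K n e))%E.

(* Bowen's definition of the topological entropy h(f|_K) of f : K -> K. The
   limit exists in \bar R: sep_growth f K is nonincreasing in e. Only the values
   of f on K matter when K is forward invariant. *)
Definition topological_entropy (R : realType) (f : R -> R) (K : set R) : \bar R :=
  lim (sep_growth f K e @[e --> 0^'+]).

Definition invariant_compact (R : realType) (f : R -> R) : set (set R) :=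
  [set K | [/\ K !=set0, compact K & f @` K `<=` K]].

(* The case split is needed because ereal_sup set0 = -oo, whereas the entropy of
   a map without nonempty invariant compact sets is +oo by convention. *)
Definition ent (R : realType) (f : R -> R) : \bar R :=
  if `[< invariant_compact f !=set0 >]
  then ereal_sup [set topological_entropy f K | K in invariant_compact f]
  else +oo%E.

Definition transitive_maps (R : realType) : set (R -> R) :=
  [set f | continuous f /\ topologically_transitive f].
Arguments transitive_maps : clear implicits.

(* Main.v *)
(* Lower bound. Let c be a fixed point of a transitive map f. If f c = c,
   c < y < x, x < f y and f x <= c, or symmetrically on the left of c, then f
   has a 2-horseshoe, and 2 > sqrt 3. Otherwise every x > c with f x <= c
   satisfies f [c, x] <= x, and symmetrically on the left. If f crosses c only
   on a bounded part of the left half line, then max f c behaves on [c, +oo[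
   like a transitive map of a half line; otherwise it also crosses arbitrarily
   far to the right, for else there is an invariant half line. If crossings
   occur arbitrarily far on both sides, then the same holds for the square of
   the map obtained from f by collapsing to c the values lying on the same side
   of c as the argument. A transitive map of a half line has arbitrarily high
   excursions upwards and downwards, and comparing them gives points
   a < y < x < b with G a <= a, G y > b, G x < a and G b = b, hence three laps over [a, b]. In the second case f ^ 2 has a
   3-horseshoe, and the overshoot above b yields one more branch of some power
   of f ^ 2, whence the strict inequality.

   Upper bound. A zigzag of slope lam slightly above 3 on [0, +oo[, with three
   laps over each [n, n + 1] overshooting a little on both sides, is transitive.
   It is the square, up to scaling, of a map of the line which exchanges the two
   half lines and has Lipschitz constant sqrt lam, so that ent <= ln (sqrt lam). *)
Require Import Defs.
From mathcomp Require Import all_boot all_order all_algebra.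
From mathcomp Require Import finmap.
From mathcomp Require Import all_classical all_reals all_analysis.
From mathcomp Require Import ring lra.

Set Implicit Arguments.
Unset Strict Implicit.
Unset Printing Implicit Defensive.

Import Order.TTheory GRing.Theory Num.Theory.
Import numFieldNormedType.Exports.

Local Open Scope classical_set_scope.
Local Open Scope ring_scope.

(** * Separated sets and growth rates *)

Lemma sep_number_ge1 (R : realType) (f : R -> R) (K : set R) n e : K !=set0 ->
  (1 <= sep_number f K n e)%E.
Proof.
move=> [x Kx]; apply: ereal_sup_ubound; exists [fset x]%fset; last by rewrite cardfs1.
split => [y /=|y z]; first by rewrite inE => /eqP ->.
by rewrite !inE => /eqP -> /eqP ->; rewrite eqxx.
Qed.

Lemma sep_growth_nonincreasing (R : realType) (f : R -> R) (K : set R) (e1 e2 : R) :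
  K !=set0 -> e1 <= e2 -> (sep_growth f K e2 <= sep_growth f K e1)%E.
Proof.
move=> K0 e12; rewrite /sep_growth !limn_esup_lim.
apply: lee_lim; [exact: is_cvg_esups|exact: is_cvg_esups|].
apply: nearW => n; apply: ge_ereal_sup => _ [k /= nk <-].
apply: (@le_trans _ _ ((k%:R^-1)%:E * lne (sep_number f K k e1))%E); last first.
  by apply: ereal_sup_ubound; exists k.
apply: lee_wpmul2l; first by rewrite lee_fin invr_ge0.
rewrite lee_lne ?in_itv/= ?leey ?andbT; last 2 first.
- by apply: le_trans (sep_number_ge1 _ _ _ K0); rewrite lee_fin.
- by apply: le_trans (sep_number_ge1 _ _ _ K0); rewrite lee_fin.
apply: ge_ereal_sup => _ [E [EK sepE] <-]; apply: ereal_sup_ubound; exists E => //.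
by split=> // x y xE yE xy; apply: le_lt_trans e12 _; exact: sepE.
Qed.

Lemma cvg_sep_growth (R : realType) (f : R -> R) (K : set R) : K !=set0 ->
  sep_growth f K e @[e --> 0^'+] --> ereal_sup (sep_growth f K @` `]0, 1[).
Proof.
move=> K0; apply: (@nonincreasing_at_right_cvge _ _ _ (BLeft 1)).
  by rewrite bnd_simp.
by move=> x y _ _ xy; exact: sep_growth_nonincreasing.
Qed.

Lemma topological_entropyE (R : realType) (f : R -> R) (K : set R) : K !=set0 ->
  topological_entropy f K = ereal_sup (sep_growth f K @` `]0, 1[).
Proof. by move=> K0; apply/cvg_lim => //; exact: cvg_sep_growth. Qed.

Lemma topological_entropy_ge (R : realType) (f : R -> R) (K : set R) (e : R)
    (l : \bar R) : K !=set0 -> 0 < e ->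
  (l <= sep_growth f K e)%E -> (l <= topological_entropy f K)%E.
Proof.
move=> K0 e0 le; rewrite topological_entropyE//.
(* The supremum ranges over ]0, 1[ only, so [e] is first lowered into that range. *)
apply: (le_trans le); apply: (@le_trans _ _ (sep_growth f K (Num.min e 2^-1))).
  by apply: sep_growth_nonincreasing => //; rewrite ge_min lexx.
apply: ereal_sup_ubound; exists (Num.min e 2^-1) => //=.
by rewrite in_itv/= lt_min e0/= gt_min; apply/andP; split; [lra|apply/orP; right; lra].
Qed.

Lemma topological_entropy_le (R : realType) (f : R -> R) (K : set R)
    (l : \bar R) : K !=set0 ->
  (forall e : R, 0 < e -> (sep_growth f K e <= l)%E) -> (topological_entropy f K <= l)%E.
Proof.
move=> K0 le; rewrite topological_entropyE//; apply: ge_ereal_sup => _ [e /= + <-].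
by rewrite in_itv/= => /andP[e0 _]; exact: le.
Qed.

(** A limit superior is bounded below along any subsequence. This form is wanted because a horseshoe
    of [iter m f] gives information at multiples of m only. *)
Lemma sep_growth_ge (R : realType) (f : R -> R) (K : set R) (e l : R) :
  (forall m, exists2 n, (m <= n)%N &
    (0 < n)%N /\ exists2 r, 0 < r & (r%:E <= sep_number f K n e)%E /\ l * n%:R <= ln r) ->
  (l%:E <= sep_growth f K e)%E.
Proof.
move=> H; rewrite /sep_growth limn_esup_lim.
apply: lime_ge; first exact: is_cvg_esups.
apply: nearW => m; have [n mn [n0 [r r0 [rs lr]]]] := H m.
apply: (@le_trans _ _ ((n%:R^-1)%:E * lne (sep_number f K n e))%E); last first.
  by apply: ereal_sup_ubound; exists n.
apply: (@le_trans _ _ ((n%:R^-1)%:E * lne r%:E)%E).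
  by rewrite lne_EFin// -EFinM lee_fin mulrC ler_pdivlMr ?ltr0n.
apply: lee_wpmul2l; first by rewrite lee_fin invr_ge0.
have r0' : (0 <= r%:E)%E by rewrite lee_fin ltW.
by rewrite lee_lne ?in_itv/= ?leey ?andbT ?(le_trans r0').
Qed.

Lemma sep_growth_le (R : realType) (f : R -> R) (K : set R) (e s C : R) :
  K !=set0 -> 1 <= s -> 0 < C ->
  (forall n, (0 < n)%N -> sep_number f K n e <= (C * s ^+ n)%:E)%E ->
  (sep_growth f K e <= (ln s)%:E)%E.
Proof.
move=> K0 s1 C0 H; have s0 : 0 < s by lra.
(* For n > 0 this is the logarithm of C * s ^ n divided by n; the contribution of C vanishes in the
   limit. *)
pose v n := (ln s + ln C * n%:R^-1)%:E.
have vl : v @ \oo --> (ln s)%:E.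
  apply: cvg_EFin; first exact: nearW.
  rewrite -[X in _ --> X]addr0; apply: cvgD; first exact: cvg_cst.
  rewrite -[X in _ --> X](mulr0 (ln C)); apply: cvgM; first exact: cvg_cst.
  by apply/(gtr0_cvgV0 (f := fun n : nat => n%:R));
    [exists 1%N => // n; rewrite /= ltr0n|exact: cvgr_idn].
have [_ <-] := cvg_limn_einf_sup vl.
rewrite /sep_growth !limn_esup_lim.
apply: lee_lim; [exact: is_cvg_esups|exact: is_cvg_esups|].
near=> m; apply: ge_ereal_sup => _ [k /= mk <-].
(* The tail has to avoid k = 0, where no bound is assumed. *)
have k0 : (0 < k)%N by apply: leq_trans mk; near: m; exists 1%N.
apply: (@le_trans _ _ (v k)); last by apply: ereal_sup_ubound; exists k.
have P0 : 0 < C * s ^+ k by rewrite mulr_gt0// exprn_gt0.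
apply: (@le_trans _ _ ((k%:R^-1)%:E * lne (C * s ^+ k)%:E)%E); last first.
  rewrite lne_EFin// lnM ?posrE ?exprn_gt0// lnXn// -EFinM /v lee_fin.
  by rewrite mulrDr -[ln s *+ k]mulr_natr [X in _ + X]mulrCA
    mulVf ?mulr1 ?pnatr_eq0 ?gtn_eqF// addrC (mulrC (ln C)).
apply: lee_wpmul2l; first by rewrite lee_fin invr_ge0.
rewrite lee_lne ?in_itv/= ?leey ?andbT ?lee_fin ?(ltW P0)//; first exact: H.
by apply: le_trans (sep_number_ge1 _ _ _ K0); rewrite lee_fin.
Unshelve. all: by end_near. Qed.

(** Pigeonhole: [phi] numbers the cells of length h that cut up [-L, L], and each cell contains at
    most one point of E. *)
Lemma card_separated (R : realType) (E : {fset R}) (L h : R) : 0 <= L -> 0 < h ->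
  (forall x, x \in E -> `|x| <= L) ->
  (forall x y, x \in E -> y \in E -> x != y -> h < `|x - y|) ->
  #|` E|%:R <= 2 * L / h + 1.
Proof.
move=> L0 h0 EL Eh.
pose phi x := Num.truncn ((x + L) / h).
have phi0 x : x \in E -> 0 <= (x + L) / h.
  by move=> /EL; rewrite ler_norml => /andP[? _]; rewrite divr_ge0 ?(ltW h0)//; lra.
have phiB x : x \in E -> (phi x)%:R <= (x + L) / h < (phi x).+1%:R.
  by move=> /phi0/truncn_itv.
have q0 : 0 <= 2 * L / h by rewrite divr_ge0 ?(ltW h0)//; lra.
have inj : {in enum_fset E &, injective phi}.
  move=> x y xE yE xy; apply/eqP/negPn/negP => /(Eh _ _ xE yE).
  have := phiB _ xE; have := phiB _ yE; rewrite -xy => /andP[y1 y2] /andP[x1 x2].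
  rewrite -natr1 in x2 y2; rewrite ltNge => /negP; apply.
  rewrite -(ler_pM2r (x := h^-1)) ?invr_gt0// mulfV ?gt_eqF//.
  rewrite -{1}(gtr0_norm (x := h^-1)) ?invr_gt0// -normrM ler_norml.
  by rewrite !mulrDl in x1 x2 y1 y2 *; rewrite mulNr; apply/andP; split; lra.
have : (size [seq phi x | x <- enum_fset E] <= size (iota 0 (Num.truncn (2 * L / h)).+1))%N.
  apply: uniq_leq_size; first by rewrite map_inj_in_uniq// fset_uniq.
  move=> _ /mapP[x xE ->]; rewrite mem_iota/= add0n ltnS.
  apply: le_truncn; apply: ler_wpM2r; first by rewrite invr_ge0 ltW.
  by move: (EL _ xE); rewrite ler_norml => /andP[_ ?]; lra.
rewrite size_map size_iota -(ler_nat R) => /le_trans; apply.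
by rewrite -natr1 lerD2r truncn_le.
Qed.

Lemma lipschitz_iter (R : realType) (f : R -> R) (s : R) : 0 <= s ->
  (forall x y, `|f x - f y| <= s * `|x - y|) ->
  forall n x y, `|iter n f x - iter n f y| <= s ^+ n * `|x - y|.
Proof.
move=> s0 fs; elim=> [|n IH] x y; first by rewrite expr0 mul1r.
by rewrite /= (le_trans (fs _ _))// exprS -mulrA ler_wpM2l.
Qed.

Lemma bowen_dist_lipschitz (R : realType) (f : R -> R) (s : R) : 1 <= s ->
  (forall x y, `|f x - f y| <= s * `|x - y|) ->
  forall n x y, bowen_dist f n x y <= s ^+ n * `|x - y|.
Proof.
move=> s1 fs n x y; have s0 : 0 <= s by apply: le_trans s1.
apply: bigmax_le => [|i _]; first by rewrite mulr_ge0// exprn_ge0.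
apply: (le_trans (lipschitz_iter s0 fs _ _ _)); apply: ler_wpM2r => //.
by apply: ler_weXn2l => //; exact: ltnW.
Qed.

(** An (n, e)-separated set is e / s ^ n-separated for the usual distance, so its size in a bounded
    set is at most a constant times s ^ n. *)
Lemma ent_lipschitz (R : realType) (f : R -> R) (s : R) : 1 <= s ->
  (forall x y, `|f x - f y| <= s * `|x - y|) ->
  invariant_compact f !=set0 -> (ent f <= (ln s)%:E)%E.
Proof.
move=> s1 fs f0; rewrite /ent asboolT//; apply: ge_ereal_sup => _ [K [K0 cK _] <-].
apply: topological_entropy_le => // e e0.
have [M [_ /(_ (`|M| + 1)) KM]] := compact_bounded cK.
have s0 : 0 < s by lra.
have M0 : 0 <= `|M| + 1 by rewrite addr_ge0.
apply: (@sep_growth_le _ _ _ _ _ (2 * (`|M| + 1) / e + 1)) => //.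
  by rewrite ltr_wpDl// divr_ge0 ?(ltW e0)// mulr_ge0.
move=> n n0; apply: ge_ereal_sup => _ [E [EK sE] <-]; rewrite lee_fin.
apply: (le_trans (@card_separated _ _ (`|M| + 1) (e / s ^+ n) M0 _ _ _)).
- by rewrite divr_gt0// exprn_gt0.
- move=> x /EK Kx; apply: KM => //; rewrite (le_lt_trans (ler_norm _))//; lra.
- move=> x y xE yE xy; rewrite ltr_pdivrMr ?exprn_gt0// mulrC.
  by apply: lt_le_trans (bowen_dist_lipschitz s1 fs _ _ _); exact: sE.
(* The additive 1 is absorbed into the constant, since 1 <= s ^ n. *)
rewrite [X in _ <= X]mulrDl mul1r; apply: lerD; last exact: exprn_ege1.
by rewrite invf_div [s ^+ n / e]mulrC mulrA.
Qed.

(** * Horseshoes *)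

Lemma continuous_iter (T : topologicalType) (f : T -> T) n :
  continuous f -> continuous (iter n f).
Proof.
move=> cf; elim: n => [|n IH] x; first exact: cvg_id.
by apply: continuous_comp; [exact: IH|exact: cf].
Qed.

Lemma compact_disjoint_dist (R : realType) (A B : set R) :
  compact A -> compact B -> A `&` B = set0 ->
  exists2 e, 0 < e & forall x y, A x -> B y -> e < `|x - y|.
Proof.
move=> cA cB AB0.
have [[p pAB]|nAB] := pselect ((A `*` B) !=set0); last first.
  by exists 1 => // x y Ax By; exfalso; apply: nAB; exists (x, y).
have [||q /set_mem[/= qA qB] qm] :=
  compact_EVT_min (f := fun p : R * R => `|p.1 - p.2|) _ (compact_setX cA cB).
- by exists p.
- apply: continuous_subspaceT => z.
  apply: (@continuous_comp _ _ _ (fun p : R * R => p.1 - p.2) Num.norm);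
    last exact: norm_continuous.
  by apply: cvgB; [exact: cvg_fst|exact: cvg_snd].
have q0 : 0 < `|q.1 - q.2|.
  rewrite normr_gt0 subr_eq0; apply/eqP => q12.
  have : (A `&` B) q.1 by split => //; rewrite q12.
  by rewrite AB0.
exists (`|q.1 - q.2| / 2); first by rewrite divr_gt0.
move=> x y Ax By; have /= := qm (x, y) (mem_set (conj Ax By)); lra.
Qed.

(** Points are pulled back along the word from its last letter to its first; S is kept along the way
    so that the next pullback is possible. *)
Lemma itinerary (T I : Type) (h : T -> T) (A : I -> set T) (S : set T) :
  (forall i x, S x -> exists2 z, A i z /\ S z & h z = x) ->
  forall k (w : nat -> I) x, S x -> exists2 z, S z /\ iter k h z = x &
    forall j, (j < k)%N -> A (w j) (iter j h z).
Proof.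
move=> H; elim=> [|k IH] w x Sx; first by exists x.
have [z [Sz zx] zA] := IH (fun n => w n.+1) x Sx.
have [y [Ay Sy] yz] := H (w 0) z Sz.
exists y; first by split=> //; rewrite iterSr yz.
by case=> // j jk; rewrite iterSr yz; exact: zA.
Qed.

(* The sets A i need not be intervals: pulling words back along h only uses
   that each A i is mapped over C. The fixed point provides an orbit that never
   leaves the union of the A i, without a compactness argument. *)
Definition horseshoe (R : realType) (h : R -> R) (I : finType) (A : I -> set R)
    (C : set R) : Prop :=
  [/\ compact C, forall i, closed (A i),
      forall i, A i `<=` C /\ C `<=` h @` A i,
      forall i j x, A i x -> A j x -> i = j &
      exists i z, A i z /\ h z = z].

Lemma horseshoe_separated (R : realType) (h : R -> R) (I : finType)
    (A : I -> set R) (C : set R) : horseshoe h A C ->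
  exists2 e : R, 0 < e &
    forall i j x y, i != j -> A i x -> A j y -> e < `|x - y|.
Proof.
move=> [cC clA AC dA _].
have cA i : compact (A i) by apply: subclosed_compact cC (AC i).1; exact: clA.
have /choice[e eP] (p : I * I) : exists e : R, 0 < e /\
    (p.1 != p.2 -> forall x y, A p.1 x -> A p.2 y -> e < `|x - y|).
  case: p => i j /=; have [ij|ij] := eqVneq i j; first by exists 1.
  have [|e e0 eA] := compact_disjoint_dist (cA i) (cA j); last by exists e.
  apply/seteqP; split => x // [ix jx].
  by move: ij; rewrite (dA _ _ _ ix jx) eqxx.
exists (\big[Order.min/1]_p e p).
  by apply: lt_bigmin => // p _; exact: (eP p).1.
move=> i j x y ij ix jy; apply: le_lt_trans ((eP (i, j)).2 ij x y ix jy).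
exact: bigmin_le.
Qed.

Definition word_set (R : realType) (h : R -> R) (I : finType) (A : I -> set R)
    (C : set R) (k : nat) (w : {ffun 'I_k -> I}) : set R :=
  [set x | C x /\ forall j : 'I_k, A (w j) (iter j h x)].

(** The branches of the power are the words of length k. Passing to a power leaves room for a branch
    that only a long iterate closes up. *)
Lemma horseshoe_iter (R : realType) (h : R -> R) (I : finType) (A : I -> set R)
    (C : set R) (k : nat) : continuous h -> horseshoe h A C ->
  horseshoe (iter k h) (@word_set _ h _ A C k) C.
Proof.
move=> ch [cC clA AC dA [i0 [z [zA hz]]]]; split=> //.
- move=> w; rewrite (_ : word_set _ _ _ _ =
      C `&` \bigcap_(j in [set: 'I_k]) (iter j h @^-1` A (w j))); last first.
    by apply/seteqP; split => x [Cx wx]; split => // j; [move=> _|]; exact: wx.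
  apply: closedI; first by apply: compact_closed => //; exact: Rhausdorff.
  apply: closed_bigI => j _; apply: preimage_closed => // x _.
  exact: continuous_iter.
- move=> w; split=> [x []//|x Cx].
  (* [itinerary] takes an infinite word, so [w] is continued by [i0] beyond k. *)
  pose v j := if insub j is Some o then w o else i0.
  have H i y : C y -> exists2 z, A i z /\ C z & h z = y.
    by move=> /(AC i).2[u Au uy]; exists u => //; split=> //; exact: (AC i).1.
  have [y [Cy yx] yA] := itinerary H k v Cx.
  exists y => //; split=> // j; have := yA _ (ltn_ord j).
  by rewrite /v valK.
- move=> w v x [_ wx] [_ vx]; apply/ffunP => j; exact: dA (wx j) (vx j).
- have hz' n : iter n h z = z by elim: n => //= n ->.
  exists [ffun=> i0], z; split=> //; split; first exact: (AC i0).1.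
  by move=> j; rewrite ffunE hz'.
Qed.

Lemma compact_bounded_orbits (R : realType) (h : R -> R) (I : finType)
    (A : I -> set R) (C : set R) : continuous h -> compact C ->
  (forall i, closed (A i)) -> (forall i, A i `<=` C) ->
  compact [set x | forall j, exists i, A i (iter j h x)].
Proof.
move=> ch cC clA AC; rewrite (_ : [set _ | _] =
  C `&` \bigcap_(j in [set: nat]) (iter j h @^-1` (\bigcup_(i in [set: I]) A i))); last first.
  apply/seteqP; split => x.
    move=> xA; split; first by have [i /AC] := xA 0.
    by move=> j _; have [i] := xA j; exists i.
  by move=> [_ xA] j; have [i _] := xA j Logic.I; exists i.
apply: compact_closedI => //; apply: closed_bigI => j _; apply: preimage_closed.
  by move=> x _; exact: continuous_iter.
by apply: closed_bigcup => //; exact: finite_finset.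
Qed.

Lemma sep_number_ge (R : realType) (f : R -> R) (K : set R) n (e : R)
    (J : finType) (p : J -> R) : (forall w, K (p w)) ->
  (forall w v, w != v -> e < bowen_dist f n (p w) (p v)) -> 0 <= e ->
  ((#|J|%:R)%:E <= sep_number f K n e)%E.
Proof.
move=> pK pe e0.
have bd0 x : bowen_dist f n x x = 0.
  by apply/le_anti/andP; split;
    [apply: bigmax_le => // i _; rewrite subrr normr0|exact: bigmax_ge_id].
have inj : injective p.
  move=> w v wv; apply/eqP/negPn/negP => /pe; rewrite wv bd0.
  by rewrite ltNge e0.
apply: ereal_sup_ubound; exists [fset p w | w in J]%fset; last first.
  by rewrite card_imfset//= -cardE.
split; first by move=> _ /= /imfsetP[w _ ->].
move=> _ _ /imfsetP[w _ ->] /imfsetP[v _ ->] wv; apply: pe.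
by apply: contra_neq wv => ->.
Qed.

(** The points whose orbit under f ^ m stays in the branches form a compact set [K'] in which every
    finite word is realised. Points with different words are separated at some multiple of m, which
    gives #|I| ^ k separated points in time m * k. *)
Lemma ent_horseshoe (R : realType) (f : R -> R) (m : nat) (I : finType)
    (A : I -> set R) (C : set R) : continuous f -> (0 < m)%N ->
  horseshoe (iter m f) A C -> ((ln #|I|%:R / m%:R)%:E <= ent f)%E.
Proof.
move=> cf m0 HS; have [e e0 eA] := horseshoe_separated HS.
have ch := @continuous_iter _ f m cf; set h := iter m f in ch HS *.
have [cC clA AC dA [i0 [z0 [z0A hz0]]]] := HS.
pose K' := [set x | forall j, exists i, A i (iter j h x)].
have K'0 : K' z0.
  by move=> j; exists i0; rewrite (_ : iter j h z0 = z0)//; elim: j => //= j ->.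
have cK' : compact K' by apply: (compact_bounded_orbits ch cC) => // i; exact: (AC i).1.
have hK' x : K' x -> K' (h x) by move=> xK j; have := xK j.+1; rewrite iterSr.
have K'h i x : K' x -> exists2 z, A i z /\ K' z & h z = x.
  move=> xK; have [i1 /(AC i1).1 Cx] := xK 0.
  have [z zA zx] := (AC i).2 _ Cx; exists z => //; split=> // -[|j]; first by exists i.
  by have := xK j; rewrite iterSr zx.
(* [K'] is invariant under f ^ m only; its first m images together are invariant under f. *)
pose K := \bigcup_(j in `I_m) (iter j f @` K').
have K'K : K' `<=` K by move=> x xK; exists 0 => //; exists x.
have K0 : K !=set0 by exists z0; exact: K'K.
have KI : invariant_compact f K.
  split=> //.
    rewrite /K bigcup_mkord; apply: bigsetU_compact => j _.
    apply: continuous_compact => //; apply: continuous_subspaceT.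
    exact: continuous_iter.
  move=> _ [_ [j /= jm [x xK <-]] <-].
  have [jm1|] := ltnP j.+1 m; first by exists j.+1 => //; exists x.
  move=> mj; have mjE : m = j.+1 by apply/eqP; rewrite eqn_leq mj jm.
  by exists 0 => //; exists (h x); [exact: hK'|rewrite /h mjE].
rewrite /ent asboolT; last by exists K.
apply: le_trans (ereal_sup_ubound _); last by exists K; [exact: KI|].
apply: (@topological_entropy_ge _ _ _ e) => //; apply: sep_growth_ge => k.
have I0 : 0 < #|I|%:R :> R by rewrite ltr0n; apply/card_gt0P; exists i0.
exists (m * k.+1)%N; first by rewrite (leq_trans _ (leq_pmull _ m0)).
split; first by rewrite muln_gt0 m0.
exists (#|I|%:R ^+ k.+1); first by rewrite exprn_gt0.
split; last first.
  by rewrite lnXn// natrM mulrA divfK ?pnatr_eq0 -?lt0n// mulr_natr.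
have /choice[p pP] (w : {ffun 'I_k.+1 -> I}) : exists z, K' z /\
    forall j : 'I_k.+1, A (w j) (iter j h z).
  have [z [Kz _] zA] := itinerary K'h k.+1 (fun j => w (inord j)) K'0.
  by exists z; split=> // j; have := zA _ (ltn_ord j); rewrite inord_val.
rewrite -natrX -{1}(card_ord k.+1) -card_ffun.
apply: (@sep_number_ge _ _ _ _ _ _ p) (ltW e0); first by move=> w; exact/K'K/(pP w).1.
move=> w v wv; have /existsP[j wvj] : [exists j, w j != v j].
  by apply: contraNT wv; rewrite negb_exists => /forallP wv; apply/eqP/ffunP => j;
    have := wv j; rewrite negbK => /eqP.
(* The words differ at letter j, so the orbits under f are more than e apart at time m * j. *)
apply: (lt_le_trans (eA _ _ _ _ wvj ((pP w).2 j) ((pP v).2 j))).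
have jm : (m * j < m * k.+1)%N by rewrite ltn_pmul2l.
have hE x : iter j h x = iter (m * j) f x.
  by elim: (j : nat) => [|i IH]; rewrite ?muln0// mulnS iterD -IH.
rewrite !hE.
exact: (le_bigmax _ (fun i : 'I_(m * k.+1) => `|iter i f (p w) - iter i f (p v)|) (Ordinal jm)).
Qed.

(** * Intermediate values and laps *)

Lemma ivt_up (R : realType) (f : R -> R) (a b v : R) : continuous f -> a <= b ->
  f a <= v <= f b -> exists2 t, a <= t <= b & f t = v.
Proof.
move=> cf ab /andP[av vb]; have [||t] := @IVT _ f a b v ab.
- exact: continuous_subspaceT.
- by rewrite ge_min av le_max vb orbT.
- by rewrite in_itv/=; exists t.
Qed.

Lemma ivt_down (R : realType) (f : R -> R) (a b v : R) : continuous f -> a <= b ->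
  f b <= v <= f a -> exists2 t, a <= t <= b & f t = v.
Proof.
move=> cf ab /andP[av vb]; have [||t] := @IVT _ f a b v ab.
- exact: continuous_subspaceT.
- by rewrite ge_min av le_max vb orbT.
- by rewrite in_itv/=; exists t.
Qed.

(** Let t be the least point of [p, q] where [phi] is nonpositive. Minimality gives the sign before
    t, and the intermediate value theorem gives the value 0 at t. *)
Lemma first_zero (R : realType) (phi : R -> R) (p q : R) : continuous phi ->
  p <= q -> 0 <= phi p -> phi q <= 0 ->
  exists t, [/\ p <= t <= q, phi t = 0 & forall s, p <= s <= t -> 0 <= phi s].
Proof.
move=> cphi pq p0 q0.
have cA : compact (`[p, q] `&` phi @^-1` `]-oo, 0]).
  apply: compact_closedI; first exact: segment_compact.
  by apply: preimage_closed => // x _; exact: cphi.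
have [||t /set_mem[/= + +] tm] := compact_EVT_min (f := id) _ cA.
- by exists q; split; rewrite /= in_itv/= ?pq ?lexx.
- by apply: continuous_subspaceT => z; exact: cvg_id.
rewrite !in_itv/= => /andP[pt tq] t0.
have tmin s : p <= s <= q -> phi s <= 0 -> t <= s.
  by move=> spq s0; apply: tm; apply/mem_set; split; rewrite /= in_itv.
have [s /andP[ps st] s0] := ivt_down (v := 0) cphi pt (introT andP (conj t0 p0)).
have ts : t = s.
  by apply/le_anti; rewrite st andbT tmin ?s0 ?ps ?(le_trans st).
exists t; split; [by rewrite pt|by rewrite ts|move=> r /andP[pr rt]].
rewrite leNgt; apply/negP => r0; have := tmin r.
rewrite pr (le_trans rt tq) (ltW r0) => /(_ isT isT) tr.
by move: r0; rewrite (_ : r = s) ?s0 ?ltxx// -ts; apply/le_anti; rewrite rt.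
Qed.

Lemma last_zero (R : realType) (phi : R -> R) (p q : R) : continuous phi ->
  p <= q -> phi p <= 0 -> 0 <= phi q ->
  exists t, [/\ p <= t <= q, phi t = 0 & forall s, t <= s <= q -> 0 <= phi s].
Proof.
move=> cphi pq p0 q0.
(* Reflection in the origin turns the last zero into a first one. *)
have [||||t [ptq t0 H]] := @first_zero _ (phi \o -%R) (- q) (- p).
- by move=> x; apply: continuous_comp; [exact: opp_continuous|exact: cphi].
- by rewrite lerN2.
- by rewrite /= opprK.
- by rewrite /= opprK.
exists (- t); split => //; first by lra.
by move=> s sq; rewrite -[s]opprK; apply: H; lra.
Qed.

(** [G] is not assumed monotone on [l, r], so a lap may be disconnected. *)
Definition lap (R : realType) (G : R -> R) (l r a b : R) : set R :=
  `[l, r] `&` G @^-1` `[a, b].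

Lemma lapP (R : realType) (G : R -> R) (l r a b t : R) :
  lap G l r a b t <-> l <= t <= r /\ a <= G t <= b.
Proof. by rewrite /lap /= !in_itv. Qed.

Lemma closed_lap (R : realType) (G : R -> R) (l r a b : R) : continuous G ->
  closed (lap G l r a b).
Proof.
move=> cG; apply: closedI; first exact: interval_closed.
by apply: preimage_closed => [x _|]; [exact: cG|exact: interval_closed].
Qed.

(** Two maps occur because [G] will be an auxiliary map with collapsed values, known to agree with
    the map [h] of interest only where its values lie in [a, b]. *)
Lemma lap_up (R : realType) (G h : R -> R) (l r a b : R) : continuous G ->
  (forall t, lap G l r a b t -> h t = G t) ->
  l <= r -> G l <= a -> b <= G r -> `[a, b] `<=` h @` lap G l r a b.
Proof.
move=> cG hG lr la rb v /=; rewrite in_itv/= => /andP[av vb].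
have [|t tlr tv] := @ivt_up _ _ _ _ v cG lr; first lra.
have lt : lap G l r a b t by apply/lapP; rewrite tv av vb.
by exists t => //; rewrite hG.
Qed.

Lemma lap_down (R : realType) (G h : R -> R) (l r a b : R) : continuous G ->
  (forall t, lap G l r a b t -> h t = G t) ->
  l <= r -> b <= G l -> G r <= a -> `[a, b] `<=` h @` lap G l r a b.
Proof.
move=> cG hG lr la rb v /=; rewrite in_itv/= => /andP[av vb].
have [|t tlr tv] := @ivt_down _ _ _ _ v cG lr; first lra.
have lt : lap G l r a b t by apply/lapP; rewrite tv av vb.
by exists t => //; rewrite hG.
Qed.

Lemma two_horseshoe (R : realType) (f : R -> R) (a y b : R) : continuous f ->
  a < y < b -> f a = a /\ b < f y /\ f b <= a \/ b <= f a /\ f y < a /\ f b = b ->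
  horseshoe f (fun i : bool => if i then lap f a y a b else lap f y b a b) `[a, b].
Proof.
move=> cf /andP[ay yb] H; split.
- exact: segment_compact.
- by case; exact: closed_lap.
- case; (split; first by move=> t /lapP[? _]; rewrite /= in_itv/=; lra).
    by case: H => -[? [? ?]]; [apply: lap_up => //|apply: lap_down => //]; lra.
  by case: H => -[? [? ?]]; [apply: lap_down => //|apply: lap_up => //]; lra.
(* The two laps can meet only at y, whose image lies outside [a, b]. *)
- have ne t : lap f a y a b t -> lap f y b a b t -> False.
    move=> /lapP[t1 t2] /lapP[t3 t4].
    by have ty : t = y by [lra|]; move: t2; rewrite ty; case: H => -[? [? ?]]; lra.
  by case=> -[] t // t1 t2; [case: (ne t)|case: (ne t)].
- case: H => -[? [? ?]].
    by exists true, a; split=> //; apply/lapP; lra.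
  by exists false, b; split=> //; apply/lapP; lra.
Qed.

Lemma three_horseshoe (R : realType) (h G : R -> R) (a y x b : R) : continuous G ->
  (forall t, a <= t <= b -> a <= G t <= b -> h t = G t) ->
  a < y -> y < x -> x < b -> G a <= a -> b < G y -> G x < a -> G b = b ->
  horseshoe h (fun i : 'I_3 => lap G (nth 0 [:: a; y; x] i) (nth 0 [:: y; x; b] i) a b)
    `[a, b].
Proof.
move=> cG hG ay yx xb Ga Gy Gx Gb; split.
- exact: segment_compact.
- by move=> i; exact: closed_lap.
- case=> -[|[|[|//]]] i3 /=; (split; first by move=> t /lapP[? _]; rewrite /= in_itv/=; lra).
  + by apply: lap_up => //; try lra; move=> t /lapP[? ?]; apply: hG; lra.
  + by apply: lap_down => //; try lra; move=> t /lapP[? ?]; apply: hG; lra.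
  + by apply: lap_up => //; try lra; move=> t /lapP[? ?]; apply: hG; lra.
(* Neighbouring laps can share only y or x, and [G] sends both outside [a, b]. *)
- case=> -[|[|[|//]]] i3 [] [|[|[|//]]] j3 t /= /lapP[t1 t2] /lapP[t3 t4];
    try exact: val_inj; exfalso; try lra.
  + by have ty : t = y by [lra|]; move: t2; rewrite ty; lra.
  + by have ty : t = y by [lra|]; move: t2; rewrite ty; lra.
  + by have ty : t = x by [lra|]; move: t2; rewrite ty; lra.
  + by have ty : t = x by [lra|]; move: t2; rewrite ty; lra.
- by exists (Ordinal (isT : (2 < 3)%N)), b; split; [apply/lapP => /=|rewrite hG]; lra.
Qed.

Lemma horseshoe_option (R : realType) (h : R -> R) (I : finType)
    (A : I -> set R) (C J : set R) : horseshoe h A C -> closed J ->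
  J `<=` C -> C `<=` h @` J -> (forall i x, A i x -> ~ J x) ->
  horseshoe h (fun o => if o is Some i then A i else J) C.
Proof.
move=> [cC clA AC dA [i0 [z zP]]] clJ JC CJ AJ; split=> //.
- by case.
- by case.
- case=> [i|] [j|] x //= Ax Bx; first by rewrite (dA _ _ _ Ax Bx).
    by case: (AJ _ _ Ax).
  by case: (AJ _ _ Bx).
- by exists (Some i0), z.
Qed.

Lemma ln_sqrt3 (R : realType) : ln (Num.sqrt 3 : R) * 2 = ln 3.
Proof.
have s3 : 0 < Num.sqrt (3 : R) by rewrite sqrtr_gt0.
by rewrite -{2}(@sqr_sqrtr R 3)// lnXn// mulr_natr.
Qed.

Lemma open_itvoo (R : realType) (a b : R) : open [set x : R | a < x < b].
Proof. by rewrite (_ : mkset _ = `]a, b[%classic). Qed.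

(* The excursion of G above the fixed point b returns to [a, b] under a power
   of f by transitivity; this adds one branch to the 3 ^ q given by the
   three-lap horseshoe, which makes the inequality strict. *)
Lemma ent_gt_ln_sqrt3 (R : realType) (f G : R -> R) (c a y x b : R) :
  continuous f -> topologically_transitive f -> continuous G -> f c = c ->
  (forall t, c <= t -> c < G t -> f t < c /\ f (f t) = G t) ->
  c < a -> a < y -> y < x -> x < b -> G a <= a -> b < G y -> G x < a -> G b = b ->
  ((ln (Num.sqrt 3))%:E < ent f)%E.
Proof.
move=> cf tf cG fc fG ca ay yx xb Ga Gy Gx Gb.
have [fb ffb] : f b < c /\ f (f b) = b by rewrite -{3}Gb; apply: fG; lra.
have f2b k : iter (2 * k) f b = b.
  by elim: k => [|k IH]; rewrite ?muln0// mulnS addnC iterD/= ffb.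
have [k [v bv Hv]] : exists k, exists2 v, b < v < G y & iter (2 * k) f v < a.
  have [||n [n0 [_ [[u /= ubG <-] /= nu]]]] := tf _ _ (@open_itvoo R b (G y)) (@open_itvoo R c a).
  - by exists ((b + G y) / 2) => /=; lra.
  - by exists ((c + a) / 2) => /=; lra.
  have [nE|nE] : n = (2 * n./2)%N \/ n = (2 * n./2).+1.
    by have := odd_double_half n; rewrite -mul2n; case: (odd n) => E; [right|left]; rewrite -{1}E.
  - by exists n./2, u => //; rewrite -nE; lra.
  (* An odd time n is made even: f ^ n sends b to f b < c and u above c, hence some v in between to
     c, and one more iterate stays at c, below a. *)
  have nb : iter n f b = f b by rewrite nE iterS f2b.
  have [||v bvu vc] := @ivt_up _ (iter n f) b u c (@continuous_iter _ f n cf).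
  - by lra.
  - by rewrite nb; lra.
  have vb : v != b by apply/eqP => vb; move: vc; rewrite vb nb; lra.
  exists n./2.+1, v; first by rewrite lt_def vb/=; lra.
  by rewrite mulnS addnC addnS addn1 -nE iterS vc fc.
have [xa xa1 Gxa] : exists2 t, y <= t <= x & G t = a by apply: ivt_down => //; lra.
have [yb yb1 Gyb] : exists2 t, y <= t <= x & G t = b by apply: ivt_down => //; lra.
have cH := @continuous_iter _ f (2 * k) cf.
(* On [b, v] the iterate goes from b to below a, so it reaches [xa] and [yb], which f ^ 2 sends to a
   and b. Hence 2 * k.+1 iterates map [l, r] over [a, b], strictly above b. *)
have [x1 x1v Hx1] : exists2 t, b <= t <= v & iter (2 * k) f t = xa.
  by apply: ivt_down => //; rewrite ?f2b; lra.
have [y1 y1v Hy1] : exists2 t, b <= t <= v & iter (2 * k) f t = yb.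
  by apply: ivt_down => //; rewrite ?f2b; lra.
have bx1 : b < x1.
  by rewrite lt_neqAle; apply/andP; split; [apply/eqP => E; move: Hx1; rewrite -E f2b|]; lra.
have by1 : b < y1.
  by rewrite lt_neqAle; apply/andP; split; [apply/eqP => E; move: Hy1; rewrite -E f2b|]; lra.
have f2x1 : iter (2 * k.+1) f x1 = a.
  by rewrite mulnS iterD Hx1 /= -Gxa; apply: (fG _ _ _).2; lra.
have f2y1 : iter (2 * k.+1) f y1 = b.
  by rewrite mulnS iterD Hy1 /= -Gyb; apply: (fG _ _ _).2; lra.
pose l := Num.min x1 y1; pose r := Num.max x1 y1.
have lb : b < l by rewrite lt_min bx1.
have rv : r <= v by rewrite ge_max; lra.
have lr : l <= r by rewrite ge_min le_max lexx.
(* The extra branch takes one step of f ^ 2 to reach [l, r] and k.+1 further steps to cover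
   [a, b]. *)
pose q := k.+2.
have H3 := @three_horseshoe _ (iter 2 f) G a y x b cG _ ay yx xb Ga Gy Gx Gb.
have {}H3 := H3 (fun t t1 t2 => (fG t ltac:(lra) ltac:(lra)).2).
have Hq := horseshoe_iter q (@continuous_iter _ f 2 cf) H3.
have fE : iter q (iter 2 f) = iter (2 * q) f.
  by apply/funext => t; elim: (q) => [|i IH]; rewrite ?muln0// mulnS iterD -IH.
have JC : lap G a y l r `<=` `[a, b].
  by move=> t /lapP[? _]; rewrite /= in_itv/=; lra.
have CJ : `[a, b] `<=` iter q (iter 2 f) @` lap G a y l r.
  move=> t tab'; have tab : a <= t <= b by move: tab'; rewrite /= in_itv.
  have [s slr st] : exists2 s, l <= s <= r & iter (2 * k.+1) f s = t.
    have cH1 := @continuous_iter _ f (2 * k.+1) cf.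
    have [xy|yx1] := leP x1 y1.
      by apply: ivt_up => //; rewrite /l /r (min_idPl xy) (max_idPr xy) f2x1 f2y1.
    by apply: ivt_down => //; rewrite /l /r (min_idPr (ltW yx1)) (max_idPl (ltW yx1)) f2x1 f2y1.
  have [||z zay zs] := @ivt_up _ G a y s cG; [lra|lra|].
  exists z; first by apply/lapP; rewrite zs.
  by rewrite fE /q mulnS addnC iterD /= (fG _ _ _).2 ?zs//; lra.
(* The first letter of a word forces G t <= b, whereas G t >= l > b on the extra branch. *)
have AJ w t : word_set (iter 2 f)
    (fun i : 'I_3 => lap G (nth 0 [:: a; y; x] i) (nth 0 [:: y; x; b] i) a b)
    `[a, b] (k := q) w t -> ~ lap G a y l r t.
  by move=> [_ /(_ ord0) /lapP[_ ?]] /lapP[_ ?]; lra.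
have := horseshoe_option Hq (@closed_lap R G a y l r cG) JC CJ AJ.
rewrite fE => /(ent_horseshoe cf _)/(lt_le_trans _); apply=> //.
(* What remains is 3 ^ q < 3 ^ q + 1. *)
rewrite lte_fin ltr_pdivlMr ?ltr0n// natrM mulrA ln_sqrt3 mulr_natr -lnXn//.
rewrite ltr_ln ?posrE ?exprn_gt0 ?ltr0n ?card_option//.
by rewrite card_ffun !card_ord -natrX ltr_nat.
Qed.

(** * Transitive maps of the line *)

Lemma max_itv (R : realType) (G : R -> R) (a b : R) : continuous G ->
  exists M, forall t, a <= t <= b -> G t <= M.
Proof.
move=> cG; have [ab|ba] := leP a b; last by exists 0 => t; lra.
have [|m _ H] := @EVT_max _ G a b ab; first exact: continuous_subspaceT.
by exists (G m) => t tab; apply: H; rewrite in_itv.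
Qed.

Lemma min_itv (R : realType) (G : R -> R) (a b : R) : continuous G ->
  exists m, forall t, a <= t <= b -> m <= G t.
Proof.
move=> cG; have [ab|ba] := leP a b; last by exists 0 => t; lra.
have [|m _ H] := @EVT_min _ G a b ab; first exact: continuous_subspaceT.
by exists (G m) => t tab; apply: H; rewrite in_itv.
Qed.

(** The point b is the first fixed point after a suitable low point, so that the excursion above b
    must come before that point. The difficulty is to place the excursion after a. *)
Lemma half_line_laps (R : realType) (G : R -> R) (c B : R) : continuous G ->
  (forall a, c < a -> exists2 x, a <= x & G x < a) ->
  (forall b, B <= b -> exists2 y, c <= y <= b & b < G y) ->
  exists a y x b, [/\ c < a, a < y, y < x & x < b] /\
    [/\ G a <= a, b < G y, G x < a & G b = b].
Proof.
move=> cG H1 H2.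
have cGi : continuous (fun t => t - G t).
  by move=> t; apply: cvgB; [exact: cvg_id|exact: cG].
have cGi' : continuous (fun t => G t - t).
  by move=> t; apply: cvgB; [exact: cG|exact: cvg_id].
have [t0 t0c Gt0] : exists2 t, c < t & G t < t.
  by have [|t tc Gt] := H1 (c + 1); [lra|exists t; lra].
have [M1 M1P] := max_itv c t0 cG.
pose M := Num.max (Num.max B t0) M1.
have [[MB Mt0] MM1] : (B <= M /\ t0 <= M) /\ M1 <= M by rewrite !le_max !lexx !orbT.
have [a aM Ga] : exists2 a, M < a & G a < a.
  by have [|t tc Gt] := H1 (M + 1); [lra|exists t; lra].
(* With b the first fixed point after x, G t <= t on [x, b]; a point sent above b therefore precedes
   x. It follows t0 because G <= M1 < b on [c, t0]. *)
have beta x : M < x -> G x < x -> exists b, [/\ x < b, G b = b &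
    exists y, [/\ t0 < y, y < x & b < G y]].
  move=> Mx Gx.
  have [q xq Gq] : exists2 q, x <= q & q <= G q.
    have [M2 M2P] := max_itv c x cG.
    have [|y yb Gy] := H2 (Num.max x M2); first by rewrite le_max; lra.
    exists y; last lra; rewrite leNgt; apply/negP => yx.
    have := M2P y; have : M2 <= Num.max x M2 by rewrite le_max lexx orbT.
    lra.
  have [||b [xbq Gb H]] := first_zero cGi xq; [lra|lra|].
  have xb : x < b.
    rewrite lt_neqAle; apply/andP; split; last lra.
    by apply/eqP => xb; move: Gb; rewrite -xb; lra.
  exists b; split=> //; first lra.
  have [|y yb Gy] := H2 b; first lra.
  exists y; split=> //.
    by rewrite ltNge; apply/negP => yt0; have := M1P y; lra.
  by rewrite ltNge; apply/negP => xy; have := H y; lra.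
(* If S is unbounded, x is taken in S above the maximum of [G] on [c, a], which forces y > a.
   Otherwise [beta] is applied to the supremum of S. *)
pose S := [set x | a <= x /\ G x < a].
have S0 : S !=set0 by have [|x ax Gx] := H1 a; [lra|exists x].
have [hS|nhS] := pselect (has_ubound S); last first.
  have [M3 M3P] := max_itv c a cG.
  have [x xS xM3] : exists2 x, S x & M3 < x.
    apply: contrapT => nx; apply: nhS; exists M3 => x xS; rewrite leNgt; apply/negP => M3x.
    by apply: nx; exists x.
  have [ax Gx] := xS; have [||b [xb Gb [y [t0y yx Gy]]]] := beta x; [lra|lra|].
  exists a, y, x, b; split; split=> //; try lra.
  by rewrite ltNge; apply/negP => ya; have := M3P y; lra.
pose X := sup S.
have SX x : S x -> x <= X by apply: ub_le_sup.
have aX : a <= X by have [x xS] := S0; have := SX x xS; case: xS; lra.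
have Xlast x : X < x -> a <= G x.
  by move=> Xx; rewrite leNgt; apply/negP => Gx; have : S x; [split; lra|move/SX; lra].
have Sapprox y : y < X -> exists2 x, S x & y < x.
  by move=> yX; have [x xS yx] := @sup_adherent R S (X - y) ltac:(lra) (conj S0 hS);
    exists x => //; rewrite -/X in yx; lra.
have GX : G X <= a.
  rewrite leNgt; apply/negP => aGX.
  have : \forall t \near X, a < G t by apply: (@cvgr_gt _ _ _ _ G (G X) (cG X)) => //; exact: cG.
  move=> /nbhs_ballP[e /= e0 He].
  have [x xS Xx] := Sapprox (X - e) ltac:(lra).
  have := He x; rewrite /ball/= ltr_norml; have := SX x xS; case: xS; move=> ? ? ? H.
  by have := H ltac:(lra); lra.
have GXX : G X < X.
  have [aX'|Xa] := ltP a X; first lra.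
  by rewrite (_ : X = a)//; lra.
have [||b [Xb Gb [y [t0y yX Gy]]]] := beta X; [lra|lra|].
have [x' [ax' Gx'] yx'] := Sapprox y yX.
have [ay|ya] := ltP a y.
  by exists a, y, x', b; have := SX x' (conj ax' Gx'); split; split=> //; lra.
(* If y <= a, the left end moves down to a fixed point al with G t >= t on [al, y]. A point beyond
   al that is sent below al then lies after y, and not after X, since G >= a there. *)
have [||al [aly Gal Hal]] := last_zero cGi' (ltW t0y); [lra|lra|].
have [|x1 alx1 Gx1] := H1 al; first lra.
have yx1 : y < x1 by rewrite ltNge; apply/negP => x1y; have := Hal x1; lra.
have x1X : x1 <= X by rewrite leNgt; apply/negP => /Xlast; lra.
have aly' : al < y.
  rewrite lt_neqAle; apply/andP; split; last lra.
  by apply/eqP => E; move: Gal; rewrite E; lra.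
by exists al, y, x1, b; split; split=> //; lra.
Qed.

Lemma transitive_noninvariant (R : realType) (f : R -> R) (W : set R) (a b p q : R) :
  topologically_transitive f -> (forall x, W x -> W (f x)) ->
  a < b -> (forall x, a < x < b -> W x) ->
  p < q -> (forall x, p < x < q -> ~ W x) -> False.
Proof.
move=> tf Wf ab Wab pq Wpq.
have [||n [n0 [_ [[u /= uab <-] /= nu]]]] := tf _ _ (@open_itvoo R a b) (@open_itvoo R p q).
- by exists ((a + b) / 2) => /=; lra.
- by exists ((p + q) / 2) => /=; lra.
apply: (Wpq _ nu); have := Wab _ uab; elim: n {n0 nu} => //= n IH Wu.
exact: Wf (IH Wu).
Qed.

(** Otherwise [a, +oo[ would be invariant; the next lemma is the mirror image. *)
Lemma transitive_below (R : realType) (f : R -> R) (a : R) :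
  topologically_transitive f -> exists2 x, a <= x & f x < a.
Proof.
move=> tf; apply: contrapT => H.
apply: (@transitive_noninvariant _ f [set x | a <= x] a (a + 1) (a - 1) a tf);
  rewrite /=; try (intros; lra).
by move=> x ax; rewrite leNgt; apply/negP => fx; apply: H; exists x.
Qed.

Lemma transitive_above (R : realType) (f : R -> R) (b : R) :
  topologically_transitive f -> exists2 y, y <= b & b < f y.
Proof.
move=> tf; apply: contrapT => H.
apply: (@transitive_noninvariant _ f [set x | x <= b] (b - 1) b b (b + 1) tf);
  rewrite /=; try (intros; lra).
by move=> x ax; rewrite leNgt; apply/negP => fx; apply: H; exists x.
Qed.

(** Some point x >= 0 moves down and some y <= 0 moves up, so the displacement changes sign. *)
Lemma transitive_fixed_point (R : realType) (f : R -> R) :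
  continuous f -> topologically_transitive f -> exists c, f c = c.
Proof.
move=> cf tf; have [x x0 fx] := transitive_below 0 tf.
have [y y0 fy] := transitive_above 0 tf.
have cphi : continuous (fun t => f t - t).
  by move=> t; apply: cvgB; [exact: cf|exact: cvg_id].
have [||t _ ft] := @ivt_down _ (fun t => f t - t) y x 0 cphi; [lra|lra|].
by exists t; lra.
Qed.

Lemma ln_sqrt3_lt_ln2 (R : realType) : ln (Num.sqrt 3 : R) < ln 2.
Proof.
rewrite -(ltr_pM2r (x := 2))// ln_sqrt3 mulr_natr -lnXn//.
by rewrite ltr_ln ?posrE ?exprn_gt0//; lra.
Qed.

Lemma ent_gt_two_horseshoe (R : realType) (f : R -> R) (a y b : R) :
  continuous f -> a < y < b ->
  f a = a /\ b < f y /\ f b <= a \/ b <= f a /\ f y < a /\ f b = b ->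
  ((ln (Num.sqrt 3))%:E < ent f)%E.
Proof.
move=> cf ayb H; have := @ent_horseshoe _ f 1 _ _ _ cf isT (two_horseshoe cf ayb H).
by apply: lt_le_trans; rewrite card_bool divr1 lte_fin ln_sqrt3_lt_ln2.
Qed.

(* Points moved far upwards lie to the right of c, so max f c behaves like a
   transitive map of the half line to the right of c. *)
Lemma ent_gt_bounded_crossings (R : realType) (f : R -> R) (c Q : R) :
  continuous f -> topologically_transitive f ->
  (forall x, x <= c -> f x <= Q) -> ((ln (Num.sqrt 3))%:E < ent f)%E.
Proof.
move=> cf tf fQ.
pose G x := Num.max (f x) c.
have cG : continuous G.
  by move=> t; apply: continuous_max; [exact: cf|exact: cvg_cst].
have [||a [y [x [b [[ca ay yx xb] [Ga Gy Gx Gb]]]]]] := @half_line_laps _ G c Q cG.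
- move=> a ca; have [x ax fx] := transitive_below a tf.
  by exists x; rewrite // /G gt_max fx.
(* Since b >= Q, a point sent above b lies to the right of c. *)
- move=> b bQ; have [y yb fy] := transitive_above b tf.
  exists y; rewrite /G ?lt_max ?fy// yb andbT leNgt; apply/negP => /ltW/fQ; lra.
have Gf t : a <= t <= b -> a <= G t <= b -> f t = G t.
  by rewrite /G; case: (leP (f t) c) => // _ ? ?; lra.
have := @ent_horseshoe _ f 1 _ _ _ cf isT (three_horseshoe cG Gf ay yx xb Ga Gy Gx Gb).
apply: lt_le_trans; rewrite card_ord divr1 lte_fin.
by apply: (lt_trans (ln_sqrt3_lt_ln2 _)); rewrite ltr_ln ?posrE//; lra.
Qed.

(** [F] is the collapsed map and [G] its square. If [G] violated a hypothesis of [half_line_laps],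
    then f would have an invariant set that transitivity forbids. *)
Lemma ent_gt_unbounded_crossings (R : realType) (f : R -> R) (c : R) :
  continuous f -> topologically_transitive f -> f c = c ->
  (forall x y, c < x -> f x <= c -> c <= y <= x -> f y <= x) ->
  (forall x y, x < c -> c <= f x -> x <= y <= c -> x <= f y) ->
  (forall M, exists2 x, M < x & f x <= c) ->
  (forall M, exists2 x, x < M & c <= f x) ->
  ((ln (Num.sqrt 3))%:E < ent f)%E.
Proof.
move=> cf tf fc NR NL UR UL.
pose F x := Num.min (f (Num.max x c)) c + Num.max (f (Num.min x c)) c - c.
have FR x : c <= x -> F x = Num.min (f x) c.
  by move=> cx; rewrite /F (max_idPl cx) (min_idPr cx) fc maxxx; lra.
have FL x : x <= c -> F x = Num.max (f x) c.
  by move=> cx; rewrite /F (max_idPr cx) (min_idPl cx) fc minxx; lra.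
have Fc : F c = c by rewrite FR// fc minxx.
have cF : continuous F.
  move=> t; apply: cvgB; last exact: cvg_cst.
  apply: cvgD.
    apply: (@continuous_min _ _ (fun x => f (Num.max x c)) (cst c)); last exact: cvg_cst.
    apply: (@continuous_comp _ _ _ (fun x => Num.max x c) f); last exact: cf.
    by apply: continuous_max; [exact: cvg_id|exact: cvg_cst].
  apply: (@continuous_max _ _ (fun x => f (Num.min x c)) (cst c)); last exact: cvg_cst.
  apply: (@continuous_comp _ _ _ (fun x => Num.min x c) f); last exact: cf.
  by apply: continuous_min; [exact: cvg_id|exact: cvg_cst].
pose G x := F (F x).
have cG : continuous G by move=> t; apply: (@continuous_comp _ _ _ F F); exact: cF.
have Gf t : c <= t -> c < G t -> f t < c /\ f (f t) = G t.
  move=> ct; rewrite /G (FR _ ct); have [ftc|ctf] := ltP (f t) c; last by rewrite Fc; lra.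
  by rewrite (FL _ (ltW ftc)); case: (leP (f (f t)) c) => //; lra.
have [||a [y [x [b [[ca ay yx xb] [Ga Gy Gx Gb]]]]]] := @half_line_laps _ G c (c + 1) cG.
- move=> a ca; apply: contrapT => H.
  have Ga x : a <= x -> a <= G x.
    by move=> ax; rewrite leNgt; apply/negP => Gx; apply: H; exists x.
  (* If [G] keeps [a, +oo[ invariant, then f sends it to the left of c and back, so together with
     its image it misses ]c, a[. *)
  apply: (@transitive_noninvariant _ f [set x | a <= x \/ exists2 t, a <= t & x = f t]
            a (a + 1) c a tf) => /=.
  + move=> x [ax|[t at' ->]]; first by right; exists x.
    by left; rewrite (Gf t _ _).2; [exact: Ga|lra|have := Ga t at'; lra].
  + by lra.
  + by move=> x ?; left; lra.
  + by lra.
  + move=> x xca [|[t at' xt]]; first lra.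
    by have [] := Gf t _ _; [lra|have := Ga t at'; lra|lra].
- move=> b cb; apply: contrapT => H.
  have Gb y : c <= y <= b -> G y <= b.
    by move=> cyb; rewrite leNgt; apply/negP => Gy; apply: H; exists y.
  (* The interval is prolonged to a crossing b2. Between b and b2 the values of f are at least c, so
     [F] collapses them and G <= b still holds. *)
  have [b2 [bb2 fb2 fbb2]] : exists b2, [/\ b <= b2, f b2 <= c &
      forall t, b < t <= b2 -> c <= f t].
    have [fbc|cfb] := leP (f b) c; first by exists b; split=> // t; lra.
    have [x bx fx] := UR b.
    have cphi : continuous (fun t => f t - c).
      by move=> t; apply: cvgB; [exact: cf|exact: cvg_cst].
    have [||t [tbx ft Ht]] := first_zero cphi (ltW bx); [lra|lra|].
    by exists t; split; [lra|lra|move=> s sbt; have := Ht s; lra].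
  have Gb2 y : c <= y <= b2 -> G y <= b.
    move=> cyb; have [yb|by'] := leP y b; first by apply: Gb; lra.
    have cy : c <= y by lra.
    rewrite /G (FR _ cy).
    have cfy : c <= f y by apply: fbb2; lra.
    by rewrite (min_idPr cfy) Fc; lra.
  have [x0 x0b x0m] : exists2 x0, c <= x0 <= b2 & forall t, c <= t <= b2 -> f x0 <= f t.
    have [||x0 x0b x0m] := @EVT_min _ f c b2; first lra.
      exact: continuous_subspaceT.
    by exists x0 => [|t tb]; [rewrite in_itv/= in x0b|apply: x0m; rewrite in_itv].
  have pc : f x0 <= c by rewrite -[X in _ <= X]fc; apply: x0m; lra.
  (* Such a t is a value of f on [c, x0], so the bound on [G] there bounds f t. *)
  have fpc t : f x0 <= t <= c -> f t <= b.
    move=> tpc.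
    have [||y cyx yt] := @ivt_down _ f c x0 t cf; [lra|by rewrite fc|].
    have cy : c <= y by lra.
    have := Gb2 y; rewrite /G (FR _ cy) yt.
    have tc : t <= c by lra.
    rewrite (min_idPl tc) FL// ge_max => H2.
    by have /andP[] : (f t <= b) && (c <= b) by apply: H2; lra.
  have [w [wp fw fwp]] : exists w, [/\ w <= f x0, c <= f w &
      forall t, w <= t < f x0 -> f t <= c].
    have [cfp|fpc'] := leP c (f (f x0)); first by exists (f x0); split=> // t; lra.
    have [x xp fx] := UL (f x0).
    have cphi : continuous (fun t => c - f t).
      by move=> t; apply: cvgB; [exact: cvg_cst|exact: cf].
    have [||t [tbx ft Ht]] := last_zero cphi (ltW xp); [lra|lra|].
    by exists t; split; [lra|lra|move=> s sbt; have := Ht s; lra].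
  (* [w, b2] is invariant: on [c, b2] by the minimality at x0 and [NR], on [w, c] by [NL] from below
     and by [fwp] and [fpc] from above. *)
  apply: (@transitive_noninvariant _ f [set x | w <= x <= b2] c b2 b2 (b2 + 1) tf) => /=;
    try (intros; lra).
  move=> t wtb; have [ct|tc] := leP c t.
    have := x0m t; have := NR b2 t; lra.
  have wt : w <= f t by apply: NL; lra.
  have [tp|pt] := ltP t (f x0); first by have := fwp t; lra.
  have := fpc t; lra.
exact: (ent_gt_ln_sqrt3 cf tf cG fc Gf ca ay yx xb Ga Gy Gx Gb).
Qed.

Lemma transitive_ent_gt (R : realType) (f : R -> R) :
  continuous f -> topologically_transitive f -> ((ln (Num.sqrt 3))%:E < ent f)%E.
Proof.
move=> cf tf; have [c fc] := transitive_fixed_point cf tf.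
have [NR|] := pselect (forall x y, c < x -> f x <= c -> c <= y <= x -> f y <= x); last first.
  move=> /existsNP[x /existsNP[y /not_implyP[cx /not_implyP[fx /not_implyP[cyx /negP]]]]].
  rewrite -ltNge => fy.
  have cy : y != c by apply/eqP => E; move: fy; rewrite E fc; lra.
  have yx : y != x by apply/eqP => E; move: fy; rewrite E; lra.
  apply: (@ent_gt_two_horseshoe _ f c y x cf); last by left.
  by rewrite !lt_neqAle yx eq_sym cy; lra.
have [NL|] := pselect (forall x y, x < c -> c <= f x -> x <= y <= c -> x <= f y); last first.
  move=> /existsNP[x /existsNP[y /not_implyP[cx /not_implyP[fx /not_implyP[cyx /negP]]]]].
  rewrite -ltNge => fy.
  have cy : y != c by apply/eqP => E; move: fy; rewrite E fc; lra.
  have yx : y != x by apply/eqP => E; move: fy; rewrite E; lra.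
  apply: (@ent_gt_two_horseshoe _ f x y c cf); last by right.
  by rewrite !lt_neqAle cy eq_sym yx; lra.
have [UL|BL] := pselect (forall M, exists2 x, x < M & c <= f x); last first.
  have {BL}[M ML] : exists M, forall x, x < M -> f x < c.
    apply: contrapT => H; apply: BL => M; apply: contrapT => H2; apply: H; exists M => x xM.
    by rewrite ltNge; apply/negP => fx; apply: H2; exists x.
  have [Q QP] := max_itv M c cf.
  apply: (@ent_gt_bounded_crossings _ f c (Num.max Q c) cf tf) => x xc.
  by rewrite le_max; have [/ML|Mx] := ltP x M; [|rewrite QP]; lra.
have [UR|BR] := pselect (forall M, exists2 x, M < x & f x <= c).
  exact: (ent_gt_unbounded_crossings cf tf fc).
have {BR}[M MR] : exists M, forall x, M < x -> c < f x.
  apply: contrapT => H; apply: BR => M; apply: contrapT => H2; apply: H; exists M => x xM.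
  by rewrite ltNge; apply/negP => fx; apply: H2; exists x.
have [P PP] := min_itv c M cf.
(* A left crossing w below all values of f on [c, +oo[; with [NL] this makes [w, +oo[ invariant. *)
have [w wPc fw] := UL (Num.min P c).
rewrite lt_min in wPc.
exfalso; apply: (@transitive_noninvariant _ f [set x | w <= x] w c (w - 1) w tf) => /=;
  try (intros; lra).
move=> x wx; have [xc|cx] := leP x c; first by apply: NL; lra.
by have [xM|/MR] := leP x M; [have := PP x|]; lra.
Qed.

(** * A transitive zigzag *)

(* The zigzag of slope lam = 3 + 4 delta, with 3 < lam <= 4: on [n, n + 1] it
   rises from n to n + d / 2 > n + 1, falls to n + (d + 1 - lam) / 2, and rises
   to n + 1. The value of the apex parameter d makes both overshoots equal to
   delta when n > 0, and keeps the map nonnegative when n = 0. *)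
Definition apex (R : realType) (lam : R) (n : nat) : R :=
  if n == 0%N then lam - 1 else (lam + 1) / 2.

(** The max-min form is defined and lam-Lipschitz on the whole line; its three pieces meet where lam
    * t is d / 2 and (d + lam - 1) / 2. *)
Definition tooth (R : realType) (lam d t : R) : R :=
  Num.max (Num.min (lam * t) (d - lam * t)) (1 - lam + lam * t).

Definition zigzag (R : realType) (lam x : R) : R :=
  let n := Num.truncn x in n%:R + tooth lam (apex lam n) (x - n%:R).

Lemma apex_bounds (R : realType) (lam : R) n : 3 < lam ->
  2 < apex lam n <= lam - 1.
Proof. by rewrite /apex; case: eqP; lra. Qed.

Lemma apexS_lt (R : realType) (lam : R) n : 3 < lam -> apex lam n.+1 < lam - 1.
Proof. by rewrite /apex /=; lra. Qed.

Lemma tooth1 (R : realType) (lam d t : R) : 3 < lam -> 2 < d <= lam - 1 ->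
  0 <= lam * t <= d / 2 -> tooth lam d t = lam * t.
Proof.
move=> lam3 d2 lt; rewrite /tooth.
by case: (leP (lam * t) (d - lam * t)) => ?; case: leP => ?; lra.
Qed.

Lemma tooth2 (R : realType) (lam d t : R) : 3 < lam -> 2 < d <= lam - 1 ->
  d / 2 <= lam * t <= (d + lam - 1) / 2 -> tooth lam d t = d - lam * t.
Proof.
move=> lam3 d2 lt; rewrite /tooth.
by case: (leP (lam * t) (d - lam * t)) => ?; case: leP => ?; lra.
Qed.

Lemma tooth3 (R : realType) (lam d t : R) : 3 < lam -> 2 < d <= lam - 1 ->
  (d + lam - 1) / 2 <= lam * t -> tooth lam d t = 1 - lam + lam * t.
Proof.
move=> lam3 d2 lt; rewrite /tooth.
by case: (leP (lam * t) (d - lam * t)) => ?; case: leP => ?; lra.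
Qed.

Lemma tooth_lipschitz (R : realType) (lam d t u : R) : 0 <= lam ->
  `|tooth lam d t - tooth lam d u| <= lam * `|t - u|.
Proof.
move=> lam0; wlog tu : t u / t <= u.
  move=> H; have [/H//|/ltW/H] := leP t u.
  by rewrite distrC [in X in _ -> X](distrC t).
have := ler_wpM2l lam0 tu; rewrite (distrC t) (ger0_norm (_ : 0 <= u - t)) ?subr_ge0//.
rewrite /tooth mulrBr ler_norml; move: (lam * t) (lam * u) => a b ab.
by case: (leP a (d - a)) => ?; case: (leP _ (1 - lam + a)) => ?;
  case: (leP b (d - b)) => ?; case: (leP _ (1 - lam + b)) => ?; lra.
Qed.

(** The right end is included: the tooth over [n, n + 1] gives n + 1 there, as does the next one. *)
Lemma zigzagE (R : realType) (lam : R) n (x : R) : 3 < lam ->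
  n%:R <= x <= n.+1%:R -> zigzag lam x = n%:R + tooth lam (apex lam n) (x - n%:R).
Proof.
move=> lam3 /andP[nx]; rewrite le_eqVlt => /orP[/eqP->|xn].
  rewrite /zigzag /= natrK subrr.
  have := apex_bounds n lam3; have := apex_bounds n.+1 lam3 => d1 d2.
  rewrite (tooth1 lam3 d1); last by rewrite mulr0; lra.
  have -> : n.+1%:R - n%:R = 1 :> R by rewrite -(natr1 n); ring.
  rewrite (tooth3 lam3 d2); last lra.
  by rewrite -(natr1 n); lra.
by rewrite /zigzag (truncn_def (n := n)) ?nx.
Qed.

Lemma zigzag1 (R : realType) (lam : R) n (x : R) : 3 < lam ->
  n%:R <= x -> lam * (x - n%:R) <= apex lam n / 2 ->
  zigzag lam x = n%:R + lam * (x - n%:R).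
Proof.
move=> lam3 nx xn; have [d1 d2] := andP (apex_bounds n lam3).
rewrite (@zigzagE _ lam n _ lam3); last first.
  rewrite nx/= -(natr1 n) -lerBlDl leNgt; apply/negP => x1.
  have : lam * 1 < lam * (x - n%:R) by rewrite ltr_pM2l//; lra.
  lra.
rewrite (tooth1 lam3 (apex_bounds n lam3))// xn andbT mulr_ge0//; lra.
Qed.

Lemma zigzag2 (R : realType) (lam : R) n (x : R) : 3 < lam ->
  apex lam n / 2 <= lam * (x - n%:R) <= (apex lam n + lam - 1) / 2 ->
  zigzag lam x = n%:R + apex lam n - lam * (x - n%:R).
Proof.
move=> lam3 xn; have [d1 d2] := andP (apex_bounds n lam3).
rewrite (@zigzagE _ lam n _ lam3); last first.
  rewrite -(natr1 n) -lerBlDl -subr_ge0; apply/andP; split.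
    by rewrite -(pmulr_rge0 _ (_ : 0 < lam)); lra.
  by rewrite -(ler_pM2l (_ : 0 < lam)); lra.
by rewrite (tooth2 lam3 (apex_bounds n lam3))//; lra.
Qed.

Lemma zigzag3 (R : realType) (lam : R) n (x : R) : 3 < lam ->
  x <= n.+1%:R -> (apex lam n + lam - 1) / 2 <= lam * (x - n%:R) ->
  zigzag lam x = n.+1%:R - lam * (n.+1%:R - x).
Proof.
move=> lam3 nx xn; have [d1 d2] := andP (apex_bounds n lam3).
rewrite (@zigzagE _ lam n _ lam3); last first.
  by rewrite nx andbT -subr_ge0 -(pmulr_rge0 _ (_ : 0 < lam)); lra.
by rewrite (tooth3 lam3 (apex_bounds n lam3))// -(natr1 n); lra.
Qed.

Lemma zigzag_nat (R : realType) (lam : R) n : 3 < lam -> zigzag lam n%:R = n%:R.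
Proof.
move=> lam3; have [d1 d2] := andP (apex_bounds n lam3).
by rewrite (@zigzag1 _ lam n _ lam3) // subrr mulr0 ?addr0// divr_ge0//; lra.
Qed.

Lemma zigzag_lipschitz (R : realType) (lam x y : R) : 3 < lam ->
  0 <= x -> 0 <= y -> `|zigzag lam x - zigzag lam y| <= lam * `|x - y|.
Proof.
move=> lam3 x0 y0; have lam1 : 1 <= lam by lra.
wlog xy : x y x0 y0 / x <= y.
  move=> H; have [/(H _ _ x0 y0)//|/ltW/(H _ _ y0 x0)] := leP x y.
  by rewrite distrC [in X in _ -> X](distrC x).
have [nx xn] := andP (truncn_itv x0); have [my ym] := andP (truncn_itv y0).
move: (Num.truncn x) (Num.truncn y) nx xn my ym => n m nx xn my ym.
have step k (t u : R) : k%:R <= t <= k.+1%:R -> k%:R <= u <= k.+1%:R ->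
    `|zigzag lam t - zigzag lam u| <= lam * `|t - u|.
  move=> kt ku; rewrite (zigzagE lam3 kt) (zigzagE lam3 ku).
  have -> : t - u = (t - k%:R) - (u - k%:R) by ring.
  rewrite opprD addrACA subrr add0r; apply: tooth_lipschitz.
  lra.
have [mn|nm] := leqP m n.
  have {}mn : m = n.
    apply/eqP; rewrite eqn_leq mn -ltnS -(ltr_nat R).
    exact: le_lt_trans nx (le_lt_trans xy ym).
  by apply: (step n); rewrite ?nx ?(ltW xn)//= -mn my ltW.
(* In different units x <= n + 1 <= m <= y; the integers between are fixed, and lam >= 1 takes care
   of the middle piece. *)
have nm' : n.+1%:R <= m%:R :> R by rewrite ler_nat.
have := step n x n.+1%:R; have := step m y m%:R.
rewrite !zigzag_nat// nx (ltW xn) my (ltW ym) !lexx !ler_nat !leqnSn.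
move=> /(_ isT isT) s1 /(_ isT isT) s2.
rewrite (ger0_norm (_ : 0 <= y - m%:R)) ?subr_ge0// in s1.
rewrite (distrC x) (ger0_norm (_ : 0 <= n.+1%:R - x)) ?subr_ge0 ?(ltW xn)// in s2.
rewrite (distrC x) (ger0_norm (_ : 0 <= y - x)) ?subr_ge0//.
have : 1 * (m%:R - n.+1%:R) <= lam * (m%:R - n.+1%:R) by rewrite ler_wpM2r ?subr_ge0.
by move: s1 s2; rewrite !ler_norml => /andP[? ?] /andP[? ?] ?; apply/andP; split; lra.
Qed.

(** The low turning value is exactly 0 on the first unit; on later units the undershoot is (lam - 3)
    / 4 <= 1 / 4. *)
Lemma zigzag_ge0 (R : realType) (lam x : R) : 3 < lam <= 4 ->
  0 <= x -> 0 <= zigzag lam x.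
Proof.
move=> /andP[lam3 lam4] x0; have [nx xn] := andP (truncn_itv x0).
rewrite (@zigzagE _ lam (Num.truncn x)) ?nx ?(ltW xn)//.
case: (Num.truncn x) nx xn => [_ _|n nx xn]; rewrite /tooth /apex /=.
  have : 0 <= lam * x by rewrite mulr_ge0//; lra.
  rewrite add0r subr0; set a := lam * x => a0.
  by case: (leP a (lam - 1 - a)) => ?; case: (leP _ (1 - lam + a)) => ?; lra.
have : 0 <= n%:R :> R by [].
rewrite -(natr1 n); set a := lam * _ => n0.
by case: (leP a ((lam + 1) / 2 - a)) => ?; case: (leP _ (1 - lam + a)) => ?; try lra;
  have : 0 <= a; [rewrite mulr_ge0//|]; lra.
Qed.

(** * Covering relations for the zigzag *)

Definition covers (R : realType) (g : R -> R) (p q r t : R) : Prop :=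
  exists2 k, (0 < k)%N & forall z, r <= z <= t -> exists2 x, p <= x <= q & iter k g x = z.

Lemma covers_trans (R : realType) (g : R -> R) (p q r t u v : R) :
  covers g p q r t -> covers g r t u v -> covers g p q u v.
Proof.
move=> [k k0 Hk] [l l0 Hl]; exists (l + k)%N; first by rewrite addn_gt0 l0.
by move=> z /Hl[y /Hk[x xpq <-] <-]; exists x => //; rewrite iterD.
Qed.

Lemma covers_sub (R : realType) (g : R -> R) (p q r t p' q' r' t' : R) :
  covers g p q r t -> p' <= p -> q <= q' -> r <= r' -> t' <= t -> covers g p' q' r' t'.
Proof.
move=> [k k0 Hk] pp qq rr tt; exists k => // z zr; have [|x xp xz] := Hk z; first lra.
by exists x => //; lra.
Qed.

Lemma covers_up (R : realType) (g : R -> R) (lam p q v : R) : 0 < lam ->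
  (forall x, p <= x <= q -> g x = v + lam * (x - p)) ->
  covers g p q v (v + lam * (q - p)).
Proof.
move=> l0 H; exists 1%N => // z /andP[z1 z2]; exists (p + (z - v) / lam).
  by rewrite lerDl divr_ge0 ?subr_ge0 ?(ltW l0)//= -lerBrDl ler_pdivrMr//; lra.
rewrite /= H.
  by rewrite addrAC subrr add0r mulrC divfK ?gt_eqF//; ring.
by rewrite lerDl divr_ge0 ?subr_ge0 ?(ltW l0)//= -lerBrDl ler_pdivrMr//; lra.
Qed.

Lemma covers_down (R : realType) (g : R -> R) (lam p q v : R) : 0 < lam ->
  (forall x, p <= x <= q -> g x = v - lam * (x - p)) ->
  covers g p q (v - lam * (q - p)) v.
Proof.
move=> l0 H; exists 1%N => // z /andP[z1 z2]; exists (p + (v - z) / lam).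
  by rewrite lerDl divr_ge0 ?subr_ge0 ?(ltW l0)//= -lerBrDl ler_pdivrMr//; lra.
rewrite /= H.
  by rewrite addrAC subrr add0r mulrC divfK ?gt_eqF//; ring.
by rewrite lerDl divr_ge0 ?subr_ge0 ?(ltW l0)//= -lerBrDl ler_pdivrMr//; lra.
Qed.

(** The local maximum point of the zigzag in [n, n + 1]; [turn2] is the local minimum point. *)
Definition turn1 (R : realType) (lam : R) (n : nat) : R :=
  n%:R + apex lam n / 2 / lam.

Definition turn2 (R : realType) (lam : R) (n : nat) : R :=
  n%:R + (apex lam n + lam - 1) / 2 / lam.

Lemma turn_bounds (R : realType) (lam : R) n : 3 < lam ->
  [/\ n%:R < turn1 lam n, turn1 lam n < turn2 lam n & turn2 lam n < n.+1%:R].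
Proof.
move=> lam3; have := apex_bounds n lam3 => d.
split; rewrite /turn1 /turn2 ?ltrDl ?ltrD2l.
- by rewrite !divr_gt0//; lra.
- by rewrite ltr_pM2r ?invr_gt0; lra.
- by rewrite -(natr1 n) ltrD2l ltr_pdivrMr; lra.
Qed.

Lemma turn1E (R : realType) (lam : R) n : 3 < lam ->
  lam * turn1 lam n = lam * n%:R + apex lam n / 2.
Proof. by move=> lam3; rewrite /turn1; field; rewrite gt_eqF//; lra. Qed.

Lemma turn2E (R : realType) (lam : R) n : 3 < lam ->
  lam * turn2 lam n = lam * n%:R + (apex lam n + lam - 1) / 2.
Proof. by move=> lam3; rewrite /turn2; field; rewrite gt_eqF//; lra. Qed.

Lemma zigzag_rise (R : realType) (lam x : R) n : 3 < lam ->
  n%:R <= x <= turn1 lam n -> zigzag lam x = n%:R + lam * (x - n%:R).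
Proof.
move=> lam3 /andP[nx xt]; apply: zigzag1 => //.
have := ler_wpM2l (_ : 0 <= lam) xt; rewrite turn1E//; lra.
Qed.

Lemma zigzag_fall (R : realType) (lam x : R) n : 3 < lam ->
  turn1 lam n <= x <= turn2 lam n ->
  zigzag lam x = n%:R + apex lam n / 2 - lam * (x - turn1 lam n).
Proof.
move=> lam3 /andP[nx xt].
have := ler_wpM2l (_ : 0 <= lam) xt; have := ler_wpM2l (_ : 0 <= lam) nx.
rewrite (turn1E n lam3) (turn2E n lam3) => H1 H2; rewrite (@zigzag2 _ lam n)//.
  by rewrite [lam * (x - turn1 lam n)]mulrBr turn1E//; lra.
by have := H1 ltac:(lra); have := H2 ltac:(lra); lra.
Qed.

Lemma zigzag_rise2 (R : realType) (lam x : R) n : 3 < lam ->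
  turn2 lam n <= x <= n.+1%:R ->
  zigzag lam x = n%:R + (apex lam n + 1 - lam) / 2 + lam * (x - turn2 lam n).
Proof.
move=> lam3 /andP[nx xt].
have := ler_wpM2l (_ : 0 <= lam) nx.
rewrite (turn2E n lam3) => H1; rewrite (@zigzag3 _ lam n)//.
  by rewrite [lam * (x - turn2 lam n)]mulrBr turn2E// -(natr1 n); lra.
by have := H1 ltac:(lra); lra.
Qed.

Definition steep (R : realType) (g : R -> R) (lam l r : R) : Prop :=
  (exists v, forall x, l <= x <= r -> g x = v + lam * (x - l)) \/
  (exists v, forall x, l <= x <= r -> g x = v - lam * (x - l)).

Lemma steep_sub (R : realType) (g : R -> R) (lam l r l' r' : R) :
  steep g lam l r -> l <= l' -> r' <= r -> steep g lam l' r'.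
Proof.
move=> [] [v H] ll rr; [left; exists (v + lam * (l' - l))|right; exists (v - lam * (l' - l))];
  by move=> x xl; rewrite H; [ring|lra].
Qed.

Lemma steep_covers (R : realType) (g : R -> R) (lam p q : R) : 0 < lam ->
  (forall x, 0 <= x -> 0 <= g x) -> 0 <= p -> p < q -> steep g lam p q ->
  exists p' q', [/\ 0 <= p', q' - p' = lam * (q - p) & covers g p q p' q'].
Proof.
move=> l0 g0 p0 pq [] [v H].
  exists v, (v + lam * (q - p)); split; [|by ring|exact: covers_up].
  by have := g0 p p0; rewrite H ?subrr ?mulr0 ?addr0//; lra.
exists (v - lam * (q - p)), v; split; [|by ring|exact: covers_down].
by rewrite -H; [apply: g0|]; lra.
Qed.

Lemma zigzag_steep (R : realType) (lam : R) n : 3 < lam ->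
  [/\ steep (zigzag lam) lam n%:R (turn1 lam n),
      steep (zigzag lam) lam (turn1 lam n) (turn2 lam n) &
      steep (zigzag lam) lam (turn2 lam n) n.+1%:R].
Proof.
move=> lam3; split; [left|right|left]; eexists => x.
- exact: zigzag_rise.
- exact: zigzag_fall.
- exact: zigzag_rise2.
Qed.

Lemma covers_rise (R : realType) (lam : R) n : 3 < lam ->
  covers (zigzag lam) n%:R (turn1 lam n) n%:R (n%:R + apex lam n / 2).
Proof.
move=> lam3; have := @covers_up _ (zigzag lam) lam n%:R (turn1 lam n) n%:R.
rewrite mulrBr turn1E// addrAC subrr add0r.
by apply; [lra|move=> x; exact: zigzag_rise].
Qed.

Lemma covers_fall (R : realType) (lam : R) n : 3 < lam ->
  covers (zigzag lam) (turn1 lam n) (turn2 lam n)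
    (n%:R + (apex lam n + 1 - lam) / 2) (n%:R + apex lam n / 2).
Proof.
move=> lam3.
have := @covers_down _ (zigzag lam) lam (turn1 lam n) (turn2 lam n) (n%:R + apex lam n / 2).
have -> : n%:R + apex lam n / 2 - lam * (turn2 lam n - turn1 lam n) =
  n%:R + (apex lam n + 1 - lam) / 2 by rewrite /turn1 /turn2; field; rewrite gt_eqF//; lra.
by apply; [lra|move=> x; exact: zigzag_fall].
Qed.

Lemma covers_rise2 (R : realType) (lam : R) n : 3 < lam ->
  covers (zigzag lam) (turn2 lam n) n.+1%:R
    (n%:R + (apex lam n + 1 - lam) / 2) n.+1%:R.
Proof.
move=> lam3.
have := @covers_up _ (zigzag lam) lam (turn2 lam n) n.+1%:R (n%:R + (apex lam n + 1 - lam) / 2).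
have -> : n%:R + (apex lam n + 1 - lam) / 2 + lam * (n.+1%:R - turn2 lam n) = n.+1%:R.
  by rewrite /turn2 -(natr1 n); field; rewrite gt_eqF//; lra.
by apply; [lra|move=> x; exact: zigzag_rise2].
Qed.

Lemma covers_unit (R : realType) (lam : R) n : 3 < lam ->
  [/\ covers (zigzag lam) n%:R (turn1 lam n) n%:R n.+1%:R,
      covers (zigzag lam) (turn1 lam n) (turn2 lam n) n%:R n.+1%:R &
      covers (zigzag lam) (turn2 lam n) n.+1%:R n%:R n.+1%:R].
Proof.
move=> lam3; have := apex_bounds n lam3; have := natr1 n => E d; split.
- by apply: covers_sub (covers_rise n lam3) _ _ _ _ => //; lra.
- by apply: covers_sub (covers_fall n lam3) _ _ _ _ => //; lra.
- by apply: covers_sub (covers_rise2 n lam3) _ _ _ _ => //; lra.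
Qed.

(** An interval that runs past r contains a whole lap. Otherwise it has at most one turning point m
    inside, and its longer part on one side of m, at least half of it, is stretched by lam > 3. *)
Lemma zigzag_grow_turn (R : realType) (lam p q l m r : R) : 3 < lam <= 4 ->
  0 <= p -> l <= p < m -> p < q -> steep (zigzag lam) lam l m ->
  steep (zigzag lam) lam m r ->
  (exists n, covers (zigzag lam) m r n%:R n.+1%:R) ->
  (exists n, covers (zigzag lam) p q n%:R n.+1%:R) \/
  exists p' q', [/\ 0 <= p', 3 / 2 * (q - p) <= q' - p' & covers (zigzag lam) p q p' q'].
Proof.
move=> lam34 p0 lpm pq S1 S2 [n C].
have lam3 : 3 < lam by lra.
have g0 x : 0 <= x -> 0 <= zigzag lam x by exact: zigzag_ge0.
have grow p1 q1 : p <= p1 -> q1 <= q -> (q - p) / 2 <= q1 - p1 ->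
    steep (zigzag lam) lam p1 q1 ->
    exists p' q', [/\ 0 <= p', 3 / 2 * (q - p) <= q' - p' & covers (zigzag lam) p q p' q'].
  move=> pp qq len S.
  have [|||||p' [q' [p'0 E D]]] := @steep_covers _ (zigzag lam) lam p1 q1 => //; try lra.
  exists p', q'; split=> //; last exact: covers_sub D _ _ _ _.
  by rewrite E; have := ler_pM2r (_ : 0 < q1 - p1) 3 lam; lra.
have [qm|mq] := leP q m.
  by right; apply: (grow p q); rewrite ?lexx//; [lra|apply: steep_sub S1 _ _; lra].
have [rq|qr] := leP r q.
  by left; exists n; apply: covers_sub C _ _ _ _ => //; lra.
right; have [h|h] := leP ((q - p) / 2) (m - p).
  by apply: (grow p m) => //; [lra|apply: steep_sub S1 _ _; lra].
by apply: (grow m q) => //; [lra|lra|apply: steep_sub S2 _ _; lra].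
Qed.

Lemma zigzag_grow (R : realType) (lam p q : R) : 3 < lam <= 4 ->
  0 <= p -> p < q ->
  (exists n, covers (zigzag lam) p q n%:R n.+1%:R) \/
  exists p' q', [/\ 0 <= p', 3 / 2 * (q - p) <= q' - p' & covers (zigzag lam) p q p' q'].
Proof.
move=> lam34 p0 pq; have lam3 : 3 < lam by lra.
have := truncn_itv p0; move: (Num.truncn p) => n np.
have [S1 S2 S3] := zigzag_steep n lam3; have [S4 _ _] := zigzag_steep n.+1 lam3.
have [C1 C2 C3] := covers_unit n lam3; have [C4 _ _] := covers_unit n.+1 lam3.
have [p1|p1] := ltP p (turn1 lam n).
  by apply: zigzag_grow_turn S1 S2 _ => //; [lra|exists n].
have [p2|p2] := ltP p (turn2 lam n).
  by apply: zigzag_grow_turn S2 S3 _ => //; [lra|exists n].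
by apply: zigzag_grow_turn S3 S4 _ => //; [lra|exists n.+1].
Qed.

Lemma exprn_unbounded (R : realType) (a e M : R) : 1 < a -> 0 < e -> exists k, M < a ^+ k * e.
Proof.
move=> a1 e0.
have [k Hk] : exists k : nat, M / e / (a - 1) < k%:R.
  by exists (Num.truncn (M / e / (a - 1))).+1; exact: truncnS_gt.
exists k; rewrite -ltr_pdivrMr//.
have : k%:R * (a - 1) <= a ^+ k.
  have /(_ k) bern : forall j, 1 + j%:R * (a - 1) <= a ^+ j.
    elim=> [|j IH]; first by rewrite mul0r addr0.
    rewrite exprS; have : a * (1 + j%:R * (a - 1)) <= a * a ^+ j.
      by apply: ler_wpM2l => //; lra.
    have : 0 <= j%:R * (a - 1) * (a - 1) by rewrite !mulr_ge0//; lra.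
    by rewrite -(natr1 j); lra.
  lra.
by apply: lt_le_trans; rewrite -ltr_pdivrMr//; lra.
Qed.

Lemma covers_some_unit (R : realType) (lam p q : R) : 3 < lam <= 4 ->
  0 <= p -> p < q -> exists n, covers (zigzag lam) p q n%:R n.+1%:R.
Proof.
move=> lam34 p0 pq; have lam3 : 3 < lam by lra.
have [k] := @exprn_unbounded R (3 / 2) (q - p) 2 ltac:(lra) ltac:(lra).
elim: k p q p0 pq => [|k IH] p q p0 pq.
  (* An interval longer than 2 contains the unit after the one in which it starts. *)
  rewrite expr0 mul1r => len; exists (Num.truncn p).+1.
  have [C _ _] := covers_unit (Num.truncn p).+1 lam3.
  have [_ t12 t2] := turn_bounds (Num.truncn p).+1 lam3.
  have := truncn_itv p0; have := natr1 (R := R) (Num.truncn p).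
  have := natr1 (R := R) (Num.truncn p).+1 => E1 E2 tp.
  by apply: covers_sub C _ _ _ _ => //; lra.
move=> len; have [//|[p' [q' [p'0 len' C]]]] := zigzag_grow lam34 p0 pq.
have [||n Cn] := IH p' q' p'0; first by lra.
  apply: (lt_le_trans len); rewrite exprSr -mulrA; apply: ler_wpM2l => //.
by exists n; exact: covers_trans C Cn.
Qed.

(** The fixed point n repels with factor lam, so a short interval at n grows until it contains the
    first lap; [covers_left_of] does the same at n + 1 with the last lap. *)
Lemma covers_right_of (R : realType) (lam s : R) n : 3 < lam -> 0 < s ->
  covers (zigzag lam) n%:R (n%:R + s) n%:R n.+1%:R.
Proof.
move=> lam3 s0; have [C _ _] := covers_unit n lam3.
have [k] := @exprn_unbounded R 3 s 1 ltac:(lra) s0.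
elim: k s s0 => [|k IH] s s0.
  rewrite expr0 mul1r => s1; apply: covers_sub C _ _ _ _ => //.
  by have [] := turn_bounds n lam3; have := natr1 (R := R) n; lra.
move=> len; have [ts|st] := leP (turn1 lam n) (n%:R + s).
  by apply: covers_sub C _ _ _ _.
have D : covers (zigzag lam) n%:R (n%:R + s) n%:R (n%:R + lam * s).
  have := @covers_up _ (zigzag lam) lam n%:R (n%:R + s) n%:R.
  rewrite [X in lam * X](_ : _ = s); last by ring.
  by apply; [lra|move=> x xn; apply: zigzag_rise => //; lra].
have l3 : 3 * s <= lam * s by rewrite ler_pM2r//; lra.
apply: (covers_trans D); apply: IH; first by lra.
by apply: (lt_le_trans len); rewrite exprSr -mulrA; apply: ler_wpM2l.
Qed.

Lemma covers_left_of (R : realType) (lam s : R) n : 3 < lam -> 0 < s ->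
  covers (zigzag lam) (n.+1%:R - s) n.+1%:R n%:R n.+1%:R.
Proof.
move=> lam3 s0; have [_ _ C] := covers_unit n lam3.
have [k] := @exprn_unbounded R 3 s 1 ltac:(lra) s0.
elim: k s s0 => [|k IH] s s0.
  rewrite expr0 mul1r => s1; apply: covers_sub C _ _ _ _ => //.
  by have [] := turn_bounds n lam3; have := natr1 (R := R) n; lra.
move=> len; have [ts|st] := leP (n.+1%:R - s) (turn2 lam n).
  by apply: covers_sub C _ _ _ _.
have D : covers (zigzag lam) (n.+1%:R - s) n.+1%:R (n.+1%:R - lam * s) n.+1%:R.
  have := @covers_up _ (zigzag lam) lam (n.+1%:R - s) n.+1%:R (n.+1%:R - lam * s).
  rewrite [X in covers _ _ _ _ X](_ : _ = n.+1%:R); last by ring.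
  apply; [lra|move=> x xn; rewrite (@zigzag_rise2 _ _ _ n)//; last lra].
  by rewrite /turn2 -(natr1 n); field; rewrite gt_eqF//; lra.
have l3 : 3 * s <= lam * s by rewrite ler_pM2r//; lra.
apply: (covers_trans D); apply: IH; first by lra.
by apply: (lt_le_trans len); rewrite exprSr -mulrA; apply: ler_wpM2l.
Qed.

(** Overshoots lead to the adjacent units: each produces an interval on the far side of a common
    integer, which then expands. Downwards this uses [apexS_lt], available for positive indices. *)
Lemma covers_units (R : realType) (lam : R) (m n : nat) : 3 < lam ->
  covers (zigzag lam) m%:R m.+1%:R n%:R n.+1%:R.
Proof.
move=> lam3.
have self k : covers (zigzag lam) k%:R k.+1%:R k%:R k.+1%:R.
  have [C _ _] := covers_unit k lam3; have [_ ? ?] := turn_bounds k lam3.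
  by apply: covers_sub C _ _ _ _ => //; lra.
have up k : covers (zigzag lam) k%:R k.+1%:R k.+1%:R k.+2%:R.
  have d := apex_bounds k lam3; have [_ ? ?] := turn_bounds k lam3.
  have E := natr1 (R := R) k.
  apply: covers_trans (covers_right_of (s := apex lam k / 2 - 1) k.+1 lam3 _); last lra.
  by apply: covers_sub (covers_rise k lam3) _ _ _ _ => //; lra.
have down k : covers (zigzag lam) k.+1%:R k.+2%:R k%:R k.+1%:R.
  have d := apex_bounds k.+1 lam3; have d' := apexS_lt k lam3.
  have [? ? ?] := turn_bounds k.+1 lam3.
  apply: covers_trans (covers_left_of (s := (lam - 1 - apex lam k.+1) / 2) k lam3 _); last lra.
  by apply: covers_sub (covers_fall k.+1 lam3) _ _ _ _ => //; lra.
have ups k j : covers (zigzag lam) k%:R k.+1%:R (j + k)%:R (j + k).+1%:R.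
  by elim: j => [|j IH]; [exact: self|exact: covers_trans IH (up _)].
have downs k j : covers (zigzag lam) (j + k)%:R (j + k).+1%:R k%:R k.+1%:R.
  by elim: j => [|j IH]; [exact: self|exact: covers_trans (down _) IH].
by have [mn|/ltnW mn] := leqP m n; rewrite -(subnK mn); [exact: ups|exact: downs].
Qed.

(** * The map of the line built from the zigzag *)

Definition swap_map (R : realType) (lam x : R) : R :=
  if 0 <= x then - (Num.sqrt lam * x) else zigzag lam (- x) / Num.sqrt lam.

Lemma zigzag0 (R : realType) (lam : R) : 3 < lam -> zigzag lam 0 = 0.
Proof. exact: (@zigzag_nat _ lam 0). Qed.

Lemma swap_map_opp (R : realType) (lam x : R) : 3 < lam -> 0 <= x ->
  swap_map lam (- x) = zigzag lam x / Num.sqrt lam.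
Proof.
move=> lam3; rewrite le_eqVlt => /orP[/eqP <-|x0].
  by rewrite /swap_map oppr0 lexx zigzag0// mulr0 mul0r oppr0.
by rewrite /swap_map oppr_ge0 leNgt x0/= opprK.
Qed.

Lemma swap_map2_opp (R : realType) (lam x : R) : 3 < lam <= 4 -> 0 <= x ->
  swap_map lam (swap_map lam (- x)) = - zigzag lam x.
Proof.
move=> lam34 x0; have lam3 : 3 < lam by lra.
have s0 : 0 < Num.sqrt lam by rewrite sqrtr_gt0; lra.
rewrite swap_map_opp// /swap_map divr_ge0 ?zigzag_ge0 ?(ltW s0)//.
by rewrite mulrC divfK ?gt_eqF.
Qed.

Lemma iter_swap_map_opp (R : realType) (lam x : R) k : 3 < lam <= 4 -> 0 <= x ->
  iter (2 * k) (swap_map lam) (- x) = - iter k (zigzag lam) x.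
Proof.
move=> lam34; elim: k x => [|k IH] x x0; first by rewrite muln0.
rewrite mulnS addnC iterD /= swap_map2_opp// IH ?zigzag_ge0//.
by rewrite -iterSr.
Qed.

(** Dividing the zigzag by sqrt lam and scaling by sqrt lam on the other side gives both branches
    the same constant. Points on opposite sides of 0 are compared through the fixed point 0. *)
Lemma swap_map_lipschitz (R : realType) (lam x y : R) : 3 < lam <= 4 ->
  `|swap_map lam x - swap_map lam y| <= Num.sqrt lam * `|x - y|.
Proof.
move=> lam34; have lam3 : 3 < lam by lra.
have s0 : 0 < Num.sqrt lam by rewrite sqrtr_gt0; lra.
have ss : lam / Num.sqrt lam = Num.sqrt lam.
  by rewrite -[in X in X / _](@sqr_sqrtr _ lam) ?expr2 ?mulfK ?gt_eqF//; lra.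
have mixed (u v : R) : 0 <= u -> 0 <= v ->
    `|swap_map lam u - swap_map lam (- v)| <= Num.sqrt lam * `|u + v|.
  move=> u0 v0; rewrite swap_map_opp// /swap_map u0.
  have gv : 0 <= zigzag lam v / Num.sqrt lam <= Num.sqrt lam * v.
    rewrite divr_ge0 ?zigzag_ge0 ?(ltW s0)//= ler_pdivrMr// mulrAC -expr2 sqr_sqrtr; last lra.
    have := @zigzag_lipschitz _ lam v 0 lam3 v0 (lexx _).
    by rewrite zigzag0// !subr0 !ger0_norm ?zigzag_ge0.
  rewrite (ger0_norm (addr_ge0 u0 v0)) ler_norml.
  have : 0 <= Num.sqrt lam * u by rewrite mulr_ge0// ltW.
  by lra.
have [x0|x0] := leP 0 x; have [y0|y0] := leP 0 y.
- rewrite /swap_map x0 y0 -opprD -mulrN -mulrDr normrN normrM gtr0_norm//.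
- by have := mixed x (- y) x0; rewrite opprK; apply; lra.
- by rewrite distrC (distrC x); have := mixed y (- x) y0; rewrite opprK; apply; lra.
- have nx : 0 <= - x by lra.
  have ny : 0 <= - y by lra.
  have := zigzag_lipschitz lam3 nx ny; rewrite -opprD normrN => L.
  rewrite -{1}[x]opprK -{1}[y]opprK !swap_map_opp//.
  rewrite -mulrBl normrM (gtr0_norm (x := _^-1)) ?invr_gt0// -[in X in _ <= X]ss mulrAC.
  by rewrite ler_pM2r ?invr_gt0.
Qed.

Lemma lipschitz_continuous (R : realType) (f : R -> R) (s : R) : 0 < s ->
  (forall x y, `|f x - f y| <= s * `|x - y|) -> continuous f.
Proof.
move=> s0 fs x; apply/cvgrPdist_lt => e e0.
near=> y; apply: (le_lt_trans (fs _ _)); rewrite mulrC -ltr_pdivlMr//.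
by near: y; apply: (@cvgr_dist_lt _ _ _ _ _ id x) => //; rewrite divr_gt0.
Unshelve. all: by end_near. Qed.

(** The interval avoids 0, so that a single formula of [swap_map] applies on it. *)
Lemma open_itv_sub (R : realType) (U : set R) : open U -> U !=set0 ->
  exists p q, [/\ p < q, 0 < p \/ q < 0 & forall x, p <= x <= q -> U x].
Proof.
move=> oU [u Uu]; have /nbhs_ballP[e /= e0 He] := open_nbhs_nbhs (conj oU Uu).
have [u0|u0] := leP 0 u.
  exists (u + e / 3), (u + e / 2); split; [lra|left; lra|move=> x xu].
  by apply: He; rewrite /ball/= ltr_norml; lra.
exists (u - e / 2), (u - e / 3); split; [lra|right; lra|move=> x xu].
by apply: He; rewrite /ball/= ltr_norml; lra.
Qed.

Lemma swap_map_transitive (R : realType) (lam : R) : 3 < lam <= 4 ->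
  topologically_transitive (swap_map lam).
Proof.
move=> lam34 U V oU oV U0 V0; have lam3 : 3 < lam by lra.
have s0 : 0 < Num.sqrt lam by rewrite sqrtr_gt0; lra.
(* Source and target are both transported to the negative half line, where the square is the
   reflected zigzag; [i] is 1 if the interval found in U is positive. *)
have [i [p [q [p0 pq HU]]]] : exists i p q, [/\ 0 <= p, p < q &
    forall y, p <= y <= q -> exists2 u, U u & iter i (swap_map lam) u = - y].
  have [p [q [pq pq0 HU]]] := open_itv_sub oU U0.
  case: pq0 => [p0|q0].
    exists 1%N, (Num.sqrt lam * p), (Num.sqrt lam * q).
    split; [by rewrite mulr_ge0 ?(ltW s0) ?(ltW p0)|by rewrite ltr_pM2l|move=> y pyq].
    exists (y / Num.sqrt lam); first by apply: HU; rewrite ler_pdivlMr// ler_pdivrMr//; lra.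
    have sp0 : 0 < Num.sqrt lam * p by rewrite mulr_gt0.
    have y0 : 0 <= y by lra.
    by rewrite /= /swap_map divr_ge0 ?(ltW s0)// mulrC divfK ?gt_eqF.
  exists 0%N, (- q), (- p); split; [lra|lra|move=> y pyq].
  by exists (- y) => //; apply: HU; lra.
have [j [m [z mz Hz]]] : exists j m, exists2 z : R, m%:R <= z <= m.+1%:R &
    V (iter j (swap_map lam) (- z)).
  have [r [t [rt rt0 HV]]] := open_itv_sub oV V0.
  case: rt0 => [r0|t0].
    have sr0 : 0 < Num.sqrt lam * r by rewrite mulr_gt0.
    have sr := truncn_itv (ltW sr0); move: (Num.truncn _) sr => m sr.
    have [k k0 Hk] := covers_units m m lam3.
    have [|x xm xz] := Hk (Num.sqrt lam * r); first lra.
    have m0 : 0 <= m%:R :> R by [].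
    have x0 : 0 <= x by lra.
    (* The last zigzag step is only half performed: one application of the map after k - 1 squares
       ends on the positive side, at r. *)
    exists (2 * k.-1).+1, m, x => //.
    rewrite (_ : iter _ _ _ = r); first by apply: HV; lra.
    have gk0 n : 0 <= iter n (zigzag lam) x by elim: n => //= n; exact: zigzag_ge0.
    rewrite iterS iter_swap_map_opp// swap_map_opp//.
    by rewrite -iterS prednK// xz mulrC mulKf ?gt_eqF.
  have r0 : 0 <= - r by lra.
  have sr := truncn_itv r0; move: (Num.truncn _) sr => m sr.
  exists 0%N, m, (- r); first lra.
  by rewrite /= opprK; apply: HV; lra.
have [n C] := covers_some_unit lam34 p0 pq.
have [k k0 Hk] := covers_trans C (covers_units n m lam3).
have [y ypq yz] := Hk z mz; have [u Uu uy] := HU y ypq.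
exists (j + (2 * k + i))%N; split; first by
  rewrite addn_gt0 addn_gt0 (_ : 0 < 2 * k)%N ?orbT// muln_gt0.
exists (iter j (swap_map lam) (- z)); split=> //; exists u => //.
by rewrite iterD iterD uy iter_swap_map_opp ?yz//; lra.
Qed.

Lemma swap_map_transitive_maps (R : realType) (lam : R) : 3 < lam <= 4 ->
  transitive_maps R (swap_map lam).
Proof.
move=> lam34; split; last exact: swap_map_transitive.
apply: (@lipschitz_continuous _ _ (Num.sqrt lam)); first by rewrite sqrtr_gt0; lra.
by move=> x y; exact: swap_map_lipschitz.
Qed.

Lemma ent_swap_map (R : realType) (lam : R) : 3 < lam <= 4 ->
  (ent (swap_map lam) <= (ln (Num.sqrt lam))%:E)%E.
Proof.
move=> lam34; apply: ent_lipschitz.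
- by rewrite -[X in X <= _]sqrtr1 ler_sqrt; lra.
- by move=> x y; exact: swap_map_lipschitz.
- exists [set 0]; split; [by exists 0|exact: compact_set1|].
  by move=> _ [_ -> <-]; rewrite /swap_map lexx mulr0 oppr0.
Qed.

Theorem theorem12 (R : realType) :
  ereal_inf [set ent f | f in transitive_maps R] = (ln (Num.sqrt 3))%:E /\
  ~ (exists f : R -> R, transitive_maps R f /\ ent f = (ln (Num.sqrt 3))%:E).
Proof.
split; last first.
  by move=> [f [[cf tf] fE]]; have := transitive_ent_gt cf tf; rewrite fE ltxx.
apply/le_anti/andP; split; last first.
  by apply: le_ereal_inf_tmp => _ [f [cf tf] <-]; exact/ltW/transitive_ent_gt.
apply/lee_addgt0Pr => e e0; rewrite -EFinD.
(* This gives sqrt lam <= sqrt 3 * exp e; the cap at 4 keeps the zigzag nonnegative. *)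
pose lam : R := Num.min 4 (3 * expR (2 * e)).
have lam34 : 3 < lam <= 4.
  rewrite /lam lt_min ge_min lexx andbT; apply/andP; split; first lra.
  by rewrite ltr_pMr// expR_gt1; lra.
apply: (@le_trans _ _ (ent (swap_map lam))).
  by apply: ereal_inf_lbound; exists (swap_map lam) => //; exact: swap_map_transitive_maps.
apply: (le_trans (ent_swap_map lam34)); rewrite lee_fin.
rewrite -(expRK e) -lnM ?posrE ?expR_gt0 ?sqrtr_gt0//.
have eE : expR e = Num.sqrt (expR (2 * e)).
  by rewrite expRM_natl sqrtr_sqr ger0_norm// expR_ge0.
rewrite eE -sqrtrM// ler_ln ?posrE ?sqrtr_gt0; [|lra|rewrite mulr_gt0 ?expR_gt0//].
by rewrite ler_sqrt ?mulr_ge0 ?expR_ge0// ge_min lexx orbT.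
Qed.
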